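(* Let $d\ge1$ be an integer and let $\mathcal{D}_d$ be the set of partitions in which any two consecutive parts differ by at least $d$ (no restriction on the number of parts). Let $D_d(x)$ be the limit shape of $\mathcal{D}_d$ and $D_d^{(-1)}$ its compositional inverse. Then \[ D_d^{(-1)}(x)=\frac wc\log\left[\left(e^{\frac{c\gamma}{w}d}-e^{\frac{c\gamma}{w}(d-1)}\right)\frac{e^{-\frac{cd}{w}x}}{1-e^{-\frac cwx}}\right],\qquad x>0,\] where \[ w=\sqrt{1-\tfrac d2\gamma^2},\qquad \gamma=\frac{-\log(1-y_d)}{\sqrt{\mathrm{Li}_2(y_d)+\frac d2\log^2(1-y_d)}},\] $y_d$ is the unique solution of $(1-y)^d=y$ in $(0,1)$, and $c$ is the solution of $c=\sqrt{\mathrm{Li}_2\big(1-e^{-c\gamma/w}\big)}$.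
   Context: $\mathrm{Li}_2(x)=\sum_{k\ge1}x^k/k^2$ is the dilogarithm. For a partition $\lambda$ of $n$ let $D_\lambda(t)=\#\{\text{parts }\ge t\}$. For a scaling function $\alpha$ (positive, increasing, $\to\infty$), $\widehat D_\lambda(t)=\frac{\alpha(n)}nD_\lambda(\alpha(n)t)$. For a set $\mathcal{A}$ of partitions with $\mathbb{P}_n$ uniform on its elements of size $n$, a piecewise continuous $\Phi\ge0$ with $\int_0^\infty\Phi=1$ is the limit shape of $\mathcal{A}$ if for some scaling function $\alpha$, all finitely many continuity points $t_j$ and $\epsilon>0$, $\mathbb{P}_n(|\widehat D_\lambda(t_j)-\Phi(t_j)|<\epsilon\ \forall j)\to1$.
   Formalization: The scaling function is fixed as α(n)=√n, since a limit shape for arbitrary α is determined only up to Φ(t)→kΦ(kt); the inverse formula is asserted for those x>0 that are values of D_d on t>0 (x<γ); c is the positive solution. *)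

(* Defs.v *)
From mathcomp Require Import all_boot all_order all_algebra.
From mathcomp Require Import finmap.
From mathcomp Require Import all_classical all_reals all_analysis.

Set Implicit Arguments.
Unset Strict Implicit.
Unset Printing Implicit Defensive.

Import Order.TTheory GRing.Theory Num.Theory.
Import numFieldNormedType.Exports.

Local Open Scope classical_set_scope.
Local Open Scope ring_scope.

Definition Li2 {R : realType} (x : R) : R :=
  limn [series x ^+ k.+1 / k.+1%:R ^+ 2]_k.

(* A partition is the sequence of its parts in weakly decreasing order; its
   size is [sumn lam]. *)
Definition is_partition (lam : seq nat) : bool :=
  sorted geq lam && (0%N \notin lam).

Definition partitions_diff (d : nat) : set (seq nat) :=
  [set lam | is_partition lam /\ sorted (fun a b => b + d <= a)%N lam].

Definition num_parts_ge {R : realType} (lam : seq nat) (t : R) : nat :=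
  count (fun p : nat => t <= p%:R) lam.

Definition scaled_diagram {R : realType} (alpha : nat -> R)
    (lam : seq nat) (t : R) : R :=
  alpha (sumn lam) / (sumn lam)%:R
  * (num_parts_ge lam (alpha (sumn lam) * t))%:R.

Definition of_size (A : set (seq nat)) (n : nat) : set (seq nat) :=
  A `&` [set lam | sumn lam = n].

(* The set [of_size A n] is finite whenever [A] consists of partitions, so that
   [fset_set] does not return its default value. *)
Definition uniform_prob {R : realType} (A : set (seq nat)) (n : nat)
    (E : set (seq nat)) : R :=
  #|` fset_set (of_size A n `&` E)|%:R / #|` fset_set (of_size A n)|%:R.

Definition scaling_function {R : realType} (alpha : nat -> R) : Prop :=
  [/\ forall n, (0 < n)%N -> 0 < alpha n,
      forall m n, (m < n)%N -> alpha m < alpha n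
    & alpha n @[n --> \oo] --> +oo].

(* Only the values on the open half-line matter; a singularity at 0 is
   allowed, as for the limit shape of unrestricted partitions. *)
Definition piecewise_continuous {R : realType} (Phi : R -> R) : Prop :=
  (forall a b, 0 < a ->
     finite_set [set t | a <= t <= b /\ ~ {for t, continuous Phi}]) /\
  (forall t, 0 < t ->
     cvg (Phi x @[x --> t^'-]) /\ cvg (Phi x @[x --> t^'+])).

(* [alpha] is kept as a parameter: if [Phi] is a limit shape for [alpha], then
   [fun t => k * Phi (k * t)] is one for [k * alpha], for every [k > 0], so a
   limit shape is determined only once the scaling function is. *)
Definition limit_shape {R : realType} (alpha : nat -> R)
    (A : set (seq nat)) (Phi : R -> R) : Prop :=
  [/\ scaling_function alpha,
      piecewise_continuous Phi,
      forall t, 0 < t -> 0 <= Phi t,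
      (\int[lebesgue_measure]_(t in `]0%R, +oo[) (Phi t)%:E = 1)%E
    & forall (ts : seq R) (eps : R),
        (forall t, t \in ts -> 0 < t /\ {for t, continuous Phi}) -> 0 < eps ->
        (uniform_prob A n
           [set lam | forall t, t \in ts ->
              `|scaled_diagram alpha lam t - Phi t| < eps] : R)
          @[n --> \oo] --> (1 : R)].

(* Limit shapes may be changed at isolated points, so uniqueness can only be
   asked at points of continuity. *)
Definition the_limit_shape {R : realType} (alpha : nat -> R)
    (A : set (seq nat)) (Phi : R -> R) : Prop :=
  limit_shape alpha A Phi /\
  forall Psi : R -> R, limit_shape alpha A Psi ->
    forall t, 0 < t -> {for t, continuous Phi} -> {for t, continuous Psi} ->
      Psi t = Phi t.

(* [f] and [g] are inverse to each other as partial functions on the open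
   half-line: [x > 0] is a value of [f] on it exactly when [g x > 0]. *)
Definition compositional_inverse {R : realType} (f g : R -> R) : Prop :=
  forall t x, 0 < t -> 0 < x -> (f t = x <-> t = g x).

Definition is_yd {R : realType} (d : nat) (y : R) : Prop :=
  0 < y < 1 /\ (1 - y) ^+ d = y.

Definition gamma_of {R : realType} (d : nat) (y : R) : R :=
  - ln (1 - y) / Num.sqrt (Li2 y + d%:R / 2 * ln (1 - y) ^+ 2).

Definition w_of {R : realType} (d : nat) (gamma : R) : R :=
  Num.sqrt (1 - d%:R / 2 * gamma ^+ 2).

(* [0 < c] excludes the trivial solution [c = 0]. *)
Definition is_c {R : realType} (gamma w c : R) : Prop :=
  0 < c /\ c = Num.sqrt (Li2 (1 - expR (- (c * gamma / w)))).

(* Main.v *)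
Require Import Defs.
From mathcomp Require Import all_boot all_order all_algebra.
From mathcomp Require Import finmap.
From mathcomp Require Import all_classical all_reals all_analysis.
From mathcomp Require Import measurable_realfun ring lra zify.

Set Implicit Arguments.
Unset Strict Implicit.
Unset Printing Implicit Defensive.

Import Order.TTheory GRing.Theory Num.Theory.
Import numFieldNormedType.Exports.

Local Open Scope classical_set_scope.
Local Open Scope ring_scope.

(* A partition in the class is a hard-core configuration of parts. Giving each part
   [p] the weight [expR (- s p)], the generating function obeys
   [Z (P + 1) = Z P + a (P + 1) * Z (P + 1 - d)], whose growth rate at energy
   [t = s p] is [1 / u], where [u + expR (- t) u ^ d = 1]. With the profile
   [g t = - ln u] and [G t = d / 2 (g t) ^ 2 + Li2 (1 - expR (- g t))] one has
   [G' = - g], so [G] is convex, and this convexity alone makes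
   [expR ((G (- s d) - G (s p)) / s)] and [expR ((G (s d) - G (s (p + d))) / s)]
   super- and subsolutions of the recursion: [ln Z = G 0 / s + O(1)].
   Since the counts are monotone in the size, this gives
   [exp (2 sqrt (G 0 * n) - o(sqrt n))] partitions of [n]; tilting the weights of
   the parts that are at least [t sqrt n] bounds by Chernoff the number of those
   deviating from [g (b t) / b], [b = sqrt (G 0)], by an exponentially smaller
   quantity. At [t = 0] the saddle equation is the one defining [y_d], with
   [u = 1 - y_d], which identifies all the constants. *)

(** * The dilogarithm *)

Section Dilogarithm.
Variable R : realType.
Implicit Types x y v : R.

Lemma ln_le_subr1 x : 0 < x -> ln x <= x - 1.
Proof.
by move=> x0; rewrite -[in ln x](subrKC 1 x); apply: le_ln1Dx; lra.
Qed.

Lemma is_derive_log_sum n x :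
  is_derive x 1 (fun z : R => \sum_(k < n) z ^+ k.+1 / k.+1%:R)
    (\sum_(k < n) x ^+ k).
Proof.
elim: n => [|n IH].
  rewrite big_ord0.
  rewrite (_ : (fun z : R => _) = cst 0); last first.
    by apply/funext => z; rewrite big_ord0.
  exact: is_derive_cst.
rewrite big_ord_recr /=.
rewrite (_ : (fun z : R => _) =
  (fun z : R => \sum_(k < n) z ^+ k.+1 / k.+1%:R) \+
  (fun z => (n.+1%:R)^-1 *: z ^+ n.+1)); last first.
  by apply/funext => z; rewrite big_ord_recr /= [_^-1 *: _]mulrC.
apply: is_deriveD.
rewrite (_ : (fun z : R => _) = n.+1%:R^-1 *: (@id R ^+ n.+1)); last first.
  by apply/funext => z; rewrite -[RHS]/(_ *: ((@id R ^+ n.+1) z)) exprfctE.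
apply: is_derive_eq.
rewrite [_%:A]mulr1 [_ *: _]mulrA mulVf ?mul1r //.
Qed.

(** The remainder has derivative [z ^+ n / (1 - z)], so the mean value theorem on [[0, x]] yields
    both its sign and its size. *)
Lemma log_sum_remainder n x : 0 <= x < 1 ->
  0 <= - ln (1 - x) - \sum_(k < n) x ^+ k.+1 / k.+1%:R <= x ^+ n / (1 - x).
Proof.
move=> /andP[x0 x1].
have [<-|xn0] := eqVneq 0 x.
  rewrite subr0 ln1 big1 => [|i _]; last by rewrite exprS !mul0r.
  by rewrite oppr0 addr0 lexx divr1 exprn_ge0.
have {xn0}x0 : 0 < x by rewrite lt_neqAle xn0.
pose f z : R := - ln (1 - z) - \sum_(k < n) z ^+ k.+1 / k.+1%:R.
pose df z : R := (1 - z)^-1 - \sum_(k < n) z ^+ k.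
have fd (z : R) : z < 1 -> is_derive z (1 : R) f (df z).
  move=> z1.
  have H := is_derive_log_sum n z.
  have H2 : is_derive z (1 : R) (fun z : R => ln (1 - z)) (- (1 - z)^-1).
    have z1' : 0 < 1 - z by lra.
    have ? := @is_derive1_ln R (1 - z) z1'.
    have : is_derive z (1 : R) (@ln R \o (fun z => 1 - z)) ((1 - z)^-1 *: (-1)).
      apply: is_derive1_comp.
      by have := is_deriveB (is_derive_cst (1 : R) z 1) (is_derive_id z 1); rewrite sub0r.
    by rewrite [_ *: _]mulrN1.
  have := is_deriveB (is_deriveN H2) H; rewrite opprK; exact.
have [||c /=] := @MVT R f df 0 x x0.
- by move=> z; rewrite in_itv /= => /andP[_ zx]; apply: fd; lra.
- apply: continuous_in_subspaceT => z; rewrite inE /= in_itv /= => /andP[_ zx].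
  have z1 : z < 1 by lra.
  by apply/differentiable_continuous/derivable1_diffP; have [] := fd z z1.
rewrite in_itv /= => /andP[c0 cx].
have f0 : f 0 = 0.
  rewrite /f subr0 ln1 big1 => [|i _]; last by rewrite exprS !mul0r.
  by rewrite oppr0 addr0.
rewrite f0 !subr0 => fE.
have dfE : df c = c ^+ n / (1 - c).
  have c1 : 1 - c != 0 by lra.
  have := subrX1 c n; rewrite /df => E.
  apply: (mulIf c1); rewrite mulrBl mulVf // divfK //.
  lra.
change (0 <= f x <= x ^+ n / (1 - x)).
rewrite fE dfE; apply/andP; split.
  by apply: mulr_ge0; [apply: divr_ge0; [apply: exprn_ge0|]|]; lra.
rewrite -[leRHS]mulr1; apply: ler_pM; [by apply: divr_ge0; [apply: exprn_ge0|]; lra|lra| |lra].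
apply: ler_pM; [by apply: exprn_ge0; lra|by rewrite invr_ge0; lra| |].
  by apply: lerXn2r; rewrite ?nnegrE; lra.
by rewrite lef_pV2 ?posrE; lra.
Qed.

Lemma cvg_log_series x : 0 <= x < 1 ->
  series (fun k => x ^+ k.+1 / k.+1%:R) n @[n --> \oo] --> - ln (1 - x).
Proof.
move=> x01.
have /andP[x0 x1] := x01.
apply/cvgrPdist_le => e e0.
have : x ^+ n / (1 - x) @[n --> \oo] --> (0 * (1 - x)^-1 : R).
  by apply: cvgMl; apply: cvg_expr; rewrite ger0_norm.
rewrite mul0r => /cvgrPdist_le /(_ e e0).
apply: filterS => n; rewrite sub0r normrN.
have := log_sum_remainder n x01.
rewrite seriesEord /= => /andP[r0 r1] H.
rewrite ger0_norm //; apply: le_trans r1 _.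
exact: le_trans (ler_norm _) H.
Qed.

(** [Li2] is a [limn], meaningful only once its series converges; the logarithm series dominates it
    termwise. *)
Lemma cvg_Li2 x : 0 <= x < 1 ->
  series (fun k => x ^+ k.+1 / k.+1%:R ^+ 2) n @[n --> \oo] --> Li2 x.
Proof.
move=> x01.
apply: series_le_cvg (cvgP _ (cvg_log_series x01)) => n.
- by apply: divr_ge0; [apply: exprn_ge0; lra|apply: exprn_ge0].
- by apply: divr_ge0 => //; apply: exprn_ge0; lra.
- apply: ler_wpM2l; first by apply: exprn_ge0; lra.
  by rewrite lef_pV2 ?posrE ?exprn_gt0 // expr2 ler_peMl // ler1n.
Qed.

Lemma Li2_le_ln x : 0 <= x < 1 -> Li2 x <= - ln (1 - x).
Proof.
move=> x01.
rewrite -(cvg_lim _ (cvg_log_series x01)) //.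
apply: lim_series_le; [exact: cvgP (cvg_Li2 x01)|exact: cvgP (cvg_log_series x01)|].
move=> n; apply: ler_wpM2l; first by apply: exprn_ge0; lra.
by rewrite lef_pV2 ?posrE ?exprn_gt0 // expr2 ler_peMl // ler1n.
Qed.

Lemma Li2_ge x : 0 <= x < 1 -> x <= Li2 x.
Proof.
move=> x01.
apply: limr_ge; first exact: cvgP (cvg_Li2 x01).
exists 1%N => // n /= n1.
rewrite seriesEord /= -(prednK n1) big_ord_recl expr1 expr1n divr1 lerDl.
apply: sumr_ge0 => i _.
by apply: divr_ge0; [apply: exprn_ge0; lra|apply: exprn_ge0].
Qed.

(* Termwise convexity: [Li2 (e^z)] is a sum of the convex functions [e^(kz) / k^2]. *)
Lemma Li2_tangent x y : 0 < x < 1 -> 0 < y < 1 ->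
  Li2 x - Li2 y <= - ln (1 - x) * (ln x - ln y).
Proof.
move=> x01 y01.
have cx : 0 <= x < 1 by lra.
have cy : 0 <= y < 1 by lra.
have c1 : series (fun k => x ^+ k.+1 / k.+1%:R ^+ 2) n -
    series (fun k => y ^+ k.+1 / k.+1%:R ^+ 2) n @[n --> \oo] --> Li2 x - Li2 y.
  by apply: cvgB; exact: cvg_Li2.
have c2 : series (fun k => x ^+ k.+1 / k.+1%:R) n * (ln x - ln y) @[n --> \oo] -->
    - ln (1 - x) * (ln x - ln y).
  by apply: cvgMl; exact: cvg_log_series.
rewrite -(cvg_lim _ c1) // -(cvg_lim _ c2) //.
apply: ler_lim; [exact: cvgP c1|exact: cvgP c2|].
apply: nearW => n; rewrite !seriesEord /= -sumrB mulr_suml.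
apply: ler_sum => k _.
have xk : 0 < x ^+ k.+1 by apply: exprn_gt0; lra.
have yk : 0 < y ^+ k.+1 by apply: exprn_gt0; lra.
have k0 : (0 : R) < k.+1%:R by rewrite ltr0n.
have : ln (y ^+ k.+1 / x ^+ k.+1) <= y ^+ k.+1 / x ^+ k.+1 - 1.
  by apply: ln_le_subr1; apply: divr_gt0.
rewrite ln_div ?posrE // !lnXn; [|lra..].
rewrite -mulrnBl -[(_ - _) *+ _]mulr_natr => H.
move: (k.+1%:R : R) k0 H => K k0 H.
rewrite -subr_ge0.
(* The last factor is [r - 1 - ln r] with [r = (y / x) ^+ k.+1], hence nonnegative. *)
have -> : x ^+ k.+1 / K * (ln x - ln y) - (x ^+ k.+1 / K ^+ 2 - y ^+ k.+1 / K ^+ 2) =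
  x ^+ k.+1 / K ^+ 2 * (y ^+ k.+1 / x ^+ k.+1 - 1 - (ln y - ln x) * K).
  field; lra.
apply: mulr_ge0; last by lra.
by apply: divr_ge0; [lra|apply: exprn_ge0; lra].
Qed.

(** The derivative of the difference is [expR c + expR (- c) - 2], nonnegative because the two
    exponentials have product 1. *)
Lemma sinh_ge x : 0 <= x -> 2 * x <= expR x - expR (- x).
Proof.
rewrite le_eqVlt => /predU1P[<-|x0].
  by rewrite mulr0 oppr0 subrr.
pose f (z : R) := expR z - expR (- z) - 2 * z.
pose df (z : R) := expR z + expR (- z) - 2.
have fd (z : R) : is_derive z (1 : R) f (df z).
  apply: is_derive_eq.
  by rewrite /df /GRing.scale /=; ring.
have [|c /=] := MVT x0 (fun z _ => fd z).
  apply: continuous_subspaceT => z.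
  by apply/differentiable_continuous/derivable1_diffP; have [] := fd z.
rewrite in_itv /= => /andP[c0 cx].
rewrite /f oppr0 !(mulr0, subr0, subrr, addr0) => E.
rewrite -subr_ge0 E; apply: mulr_ge0; last exact: ltW.
rewrite /df.
have p := expR_gt0 c.
have q := expR_gt0 (- c).
have : expR c * expR (- c) = 1 by rewrite -expRD subrr expR0.
have := sqr_ge0 (expR c - expR (- c)).
nra.
Qed.

(** With [v] half of [- ln (1 - x)], dividing by [1 - x = expR (- v) ^+ 2] turns the claim into the
    square of [sinh_ge]. *)
Lemma sqr_ln_le x : 0 < x < 1 -> ln (1 - x) ^+ 2 * (1 - x) <= x ^+ 2.
Proof.
move=> x01.
pose v := - ln (1 - x) / 2.
have v0 : 0 <= v.
  by rewrite /v; apply: divr_ge0 => //; rewrite oppr_ge0; apply: ln_le0; lra.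
have := sinh_ge v0.
have eE : expR (- v) ^+ 2 = 1 - x.
  rewrite -expRM_natl /v.
  have -> : 2 * - (- ln (1 - x) / 2) = ln (1 - x) by lra.
  by rewrite lnK // posrE; lra.
have ee : expR v * expR (- v) = 1 by rewrite -expRD subrr expR0.
have -> : ln (1 - x) = - (2 * v) by rewrite /v; lra.
have -> : x = 1 - expR (- v) ^+ 2 by lra.
have p := expR_gt0 v.
have q := expR_gt0 (- v).
move: (expR v) (expR (- v)) p q ee eE => a b a0 b0 ab bE h.
have -> : (- (2 * v)) ^+ 2 * (1 - (1 - b ^+ 2)) = (2 * v * b) ^+ 2 by ring.
apply: lerXn2r; rewrite ?nnegrE; nra.
Qed.

(* [u |-> Li2 (1 - e^(-u)) / u^2] is strictly decreasing. *)
Lemma Li2_ratio_lt x y : 0 < x -> x < y -> y < 1 ->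
  Li2 y * ln (1 - x) ^+ 2 < Li2 x * ln (1 - y) ^+ 2.
Proof.
move=> x0 xy y1.
pose u := - ln (1 - x); pose v := - ln (1 - y).
have u0 : 0 < u by rewrite /u oppr_gt0; apply: ln_lt0; lra.
have uv : u < v by rewrite /u /v ltrN2 ltr_ln ?posrE; lra.
rewrite -[ln (1 - x)]opprK -[ln (1 - y)]opprK -/u -/v (sqrrN u) (sqrrN v).
have K0 : 0 < Li2 x by apply: (lt_le_trans x0); apply: Li2_ge; lra.
(* [H1] to [H3] bound the increment of [Li2] through [v - u]; [H4] then trades the factor
   [(1 - x) / x] for [Li2 x / u ^+ 2]. *)
have H1 : Li2 y - Li2 x <= v * (ln y - ln x) by apply: Li2_tangent; lra.
have H2 : ln y - ln x <= (y - x) / x.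
  rewrite -ln_div ?posrE; [|lra..].
  apply: le_trans (ln_le_subr1 _) _; first by apply: divr_gt0; lra.
  by rewrite mulrBl divff ?lexx //; lra.
have H3 : y - x <= (1 - x) * (v - u).
  have : 1 - (v - u) <= expR (- (v - u)) by have := expR_ge1Dx (- (v - u)); lra.
  have eu : expR (- u) = 1 - x by rewrite /u opprK lnK // posrE; lra.
  have ev : expR (- v) = 1 - y by rewrite /v opprK lnK // posrE; lra.
  have -> : expR (- (v - u)) = (1 - y) / (1 - x).
    by rewrite -eu -ev -expRN -expRD; congr expR; ring.
  rewrite ler_pdivlMr; last by lra.
  lra.
have H4 : u ^+ 2 * (1 - x) <= Li2 x * x.
  have := @sqr_ln_le x; rewrite -[ln (1 - x)]opprK -/u sqrrN => H.
  apply: le_trans (H _) _; first by lra.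
  by rewrite expr2 ler_wpM2r; [|lra|apply: Li2_ge; lra].
have H5 : (Li2 y - Li2 x) * x <= v * (v - u) * (1 - x).
  apply: (@le_trans _ _ (v * (y - x))).
    have : v * (ln y - ln x) <= v * ((y - x) / x) by rewrite ler_wpM2l //; lra.
    move=> h; have := le_trans H1 h => /(ler_wpM2r (ltW x0)).
    by rewrite -[v * (_ / _) * x]mulrA divfK //; lra.
  by rewrite -mulrA [(v - u) * _]mulrC ler_wpM2l //; lra.
have H6 : (Li2 y - Li2 x) * u ^+ 2 <= v * (v - u) * Li2 x.
  rewrite -(ler_pM2r x0).
  apply: (@le_trans _ _ (v * (v - u) * (1 - x) * u ^+ 2)).
    by rewrite mulrAC ler_wpM2r // sqr_ge0.
  rewrite -!mulrA ler_wpM2l //; first lra.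
  by rewrite ler_wpM2l //; lra.
(* Adding [Li2 x * u ^+ 2] to [H6] gives [Li2 y * u ^+ 2 <= Li2 x * (v ^+ 2 - u * (v - u))], and the
   subtracted term is positive. *)
have : 0 < Li2 x * (u * (v - u)) by rewrite !mulr_gt0 //; lra.
nra.
Qed.

End Dilogarithm.

(** * The saddle equation and the profile *)

(* Unification would otherwise unfold these down to limits of series. *)
#[local] Opaque expR ln Li2.

Section Profile.
Variables (R : realType) (d : nat).
Hypothesis d_gt0 : (0 < d)%N.
Implicit Types a b t u v x : R.

Lemma saddle_exists a : 0 < a -> exists u, 0 < u < 1 /\ u + a * u ^+ d = 1.
Proof.
move=> a0.
pose p : {poly R} := 'X + a *: 'X^d.
have pE u : p.[u] = u + a * u ^+ d by rewrite /p !hornerE.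
have [//|||u] := @IVT R (fun u => p.[u]) 0 1 1.
- by apply: continuous_subspaceT; exact: continuous_horner.
(* The endpoint values are 0 (as [d] is positive) and [1 + a], so the value 1 is attained. *)
- rewrite !pE expr1n expr0n eqn0Ngt d_gt0 mulr0 addr0 mulr1.
  by rewrite ge_min le_max ler01 lerDl (ltW a0) orbT.
rewrite in_itv /= pE => /andP[u0 u1] uE; exists u; split => //.
rewrite !lt_neqAle u0 u1 !andbT; apply/andP; split; apply/eqP => uu; move: uE.
  by rewrite -uu expr0n eqn0Ngt d_gt0 mulr0 addr0 => /eqP; rewrite eq_sym oner_eq0.
by rewrite uu expr1n; lra.
Qed.

Lemma saddle_inj a u v : 0 < a -> 0 < u -> 0 < v ->
  u + a * u ^+ d = 1 -> v + a * v ^+ d = 1 -> u = v.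
Proof.
move=> a0; wlog uv : u v / u <= v.
  move=> H u0 v0 uE vE; case: (leP u v) => [|/ltW] h; first exact: H.
  by apply/esym; apply: H.
move=> u0 v0 uE vE; apply/eqP; rewrite eq_le uv /=.
have : a * u ^+ d <= a * v ^+ d.
  by rewrite ler_pM2l // lerXn2r ?nnegrE // ltW.
lra.
Qed.

(* The value is chosen inside an opaque proof: conversion never unfolds it. *)
Lemma profile_exists t :
  {v : R | 0 < v /\ expR (- v) + expR (- t) * expR (- v) ^+ d = 1}.
Proof.
apply: cid; have [u [u01 uE]] := saddle_exists (expR_gt0 (- t)).
exists (- ln u); rewrite opprK lnK ?posrE; last by case/andP: u01.
by rewrite oppr_gt0 ln_lt0.
Qed.

Definition profile t : R := sval (profile_exists t).

Lemma profileP t : 0 < profile t /\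
  expR (- profile t) + expR (- t) * expR (- profile t) ^+ d = 1.
Proof. exact: svalP (profile_exists t). Qed.

Lemma profile_gt0 t : 0 < profile t.
Proof. by have [] := profileP t. Qed.

Lemma profile_unique t v : expR (- v) + expR (- t) * expR (- v) ^+ d = 1 ->
  v = profile t.
Proof.
move=> vE; apply: oppr_inj; apply: expR_inj.
apply: (saddle_inj (expR_gt0 (- t))) => //; [exact: expR_gt0..|].
by have [] := profileP t.
Qed.

Lemma expR_profile t : 0 < expR (- profile t) < 1.
Proof. by rewrite expR_gt0 expR_lt1 oppr_lt0 profile_gt0. Qed.

Lemma onem_expR_profile t : 0 < 1 - expR (- profile t) < 1.
Proof. by have /andP[] := expR_profile t; lra. Qed.

(** The saddle equation solved for [t]: the inverse of [profile] is explicit, and the formula of the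
    theorem descends from it. *)
Lemma profileK t : - d%:R * profile t - ln (1 - expR (- profile t)) = t.
Proof.
have [g0 gE] := profileP t.
have -> : 1 - expR (- profile t) = expR (- t - d%:R * profile t).
  rewrite expRD -[- (_ * _)]mulrN expRM_natl -[X in X - _]gE; ring.
by rewrite expRK; ring.
Qed.

Lemma ln_profile t : ln (1 - expR (- profile t)) = - d%:R * profile t - t.
Proof. by rewrite -[X in _ = _ - X](profileK t) subKr. Qed.

(** Both terms of the explicit inverse in [profileK] decrease with the profile value. *)
Lemma profile_anti a b : a <= b -> profile b <= profile a.
Proof.
move=> ab; rewrite leNgt; apply/negP => gab.
have : b < a.
  rewrite -(profileK a) -(profileK b); apply: ltr_leD.
    by rewrite !mulNr ltrN2 ltr_pM2l // ltr0n.
  rewrite lerN2 ler_ln ?posrE; last 2 first.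
  - by case/andP: (onem_expR_profile a).
  - by case/andP: (onem_expR_profile b).
  by rewrite lerD2l lerN2 ler_expR lerN2 ltW.
by rewrite ltNge ab.
Qed.

(** In the explicit inverse the linear term alone has slope [- d], at most -1, and the logarithmic
    term only makes it steeper. *)
Lemma profile_lipschitz a b : a <= b -> profile a - profile b <= b - a.
Proof.
move=> ab; have gab := profile_anti ab.
have H : ln (1 - expR (- profile b)) <= ln (1 - expR (- profile a)).
  rewrite ler_ln ?posrE; last 2 first.
  - by case/andP: (onem_expR_profile b).
  - by case/andP: (onem_expR_profile a).
  by rewrite lerD2l lerN2 ler_expR lerN2.
have H1 : profile a - profile b <= d%:R * (profile a - profile b).
  by rewrite ler_peMl ?ler1n // subr_ge0.
rewrite !ln_profile in H; lra.
Qed.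

Lemma profile_dist a b : `|profile a - profile b| <= `|a - b|.
Proof.
wlog ab : a b / a <= b.
  move=> H; case: (leP a b) => [|/ltW] h; first exact: H.
  by rewrite distrC [leRHS]distrC; exact: H.
rewrite ger0_norm ?subr_ge0 ?profile_anti // distrC.
by rewrite ger0_norm ?subr_ge0 // profile_lipschitz.
Qed.

Lemma continuous_profile : continuous profile.
Proof.
move=> t; apply/cvgrPdist_le => e e0; near=> x.
apply: le_trans (profile_dist _ _) _.
near: x; exact: cvgr_dist_le.
Unshelve. all: by end_near. Qed.

(** With [u = expR (- profile t)], [- ln u <= u^-1 - 1], which the saddle equation identifies as
    [expR (- t) * u ^+ d.-1]. *)
Lemma profile_le_expR t : profile t <= expR (- t).
Proof.
have [g0 gE] := profileP t; have /andP[u0 u1] := expR_profile t.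
rewrite -[profile t]opprK -[- profile t]expRK -lnV ?posrE //.
apply: le_trans (ln_le_subr1 _) _; first by rewrite invr_gt0.
move: gE u0 u1; move: (expR (- profile t)) => u uE u0 u1.
have -> : u^-1 - 1 = expR (- t) * u ^+ d.-1.
  have un0 : u != 0 by rewrite gt_eqF.
  apply: (mulIf un0); rewrite -mulrA -exprSr prednK // mulrBl mulVf //.
  by rewrite -[X in X - _]uE; ring.
rewrite ler_piMr ?expR_ge0 // exprn_ile1 //; exact: ltW.
Qed.

(* Locked, because conversion tends to unfold [Li2] down to its limit. *)
Definition profile_area : R -> R := locked (fun t =>
  d%:R / 2 * profile t ^+ 2 + Li2 (1 - expR (- profile t))).

Lemma profile_areaE t : profile_area t =
  d%:R / 2 * profile t ^+ 2 + Li2 (1 - expR (- profile t)).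
Proof. by rewrite /profile_area -lock. Qed.

Lemma profile_area_tangent a b :
  profile_area a - profile_area b <= profile a * (b - a).
Proof.
(* For profile values [p], [q], combining the quadratic term with the tangent bound for [Li2] leaves
   the surplus [- k / 2 * (p - q) ^+ 2]. *)
have aux (k p q A B : R) : 0 <= k ->
    A - B <= p * ((- k * p - a) - (- k * q - b)) ->
    k / 2 * p ^+ 2 + A - (k / 2 * q ^+ 2 + B) <= p * (b - a).
  by move=> k0 H; have := mulr_ge0 k0 (sqr_ge0 (p - q)); nra.
rewrite !profile_areaE; apply: aux => //.
have := Li2_tangent (onem_expR_profile a) (onem_expR_profile b).
by rewrite !ln_profile subKr expRK opprK.
Qed.

Lemma profile_area_ge0 t : 0 <= profile_area t.
Proof.
have /andP[/ltW u0 u1] := onem_expR_profile t.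
rewrite profile_areaE; apply: addr_ge0; first by rewrite mulr_ge0 ?sqr_ge0 // divr_ge0.
by apply: (le_trans u0); apply: Li2_ge; rewrite u0.
Qed.

(** Crude decay from [profile t <= expR (- t)]; it controls the truncation of the generating
    function and the integral at infinity. *)
Lemma profile_area_le t : 0 < t -> profile_area t <= d.+1%:R / t.
Proof.
move=> t0; have /andP[/ltW u0 u1] := onem_expR_profile t.
have h1 : profile t <= t^-1.
  apply: le_trans (profile_le_expR t) _.
  rewrite expRN lef_pV2 ?posrE ?expR_gt0 //.
  by have := expR_ge1Dx t; lra.
have h2 : profile t <= 1.
  by apply: le_trans (profile_le_expR t) _; rewrite -expR0 ler_expR; lra.
have h3 : profile t ^+ 2 <= t^-1.
  by apply: le_trans h1; rewrite expr2 ler_piMl //; exact/ltW/profile_gt0.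
have h4 : Li2 (1 - expR (- profile t)) <= profile t.
  have := @Li2_le_ln R (1 - expR (- profile t)).
  by rewrite subKr expRK opprK; apply; rewrite u0.
have ti : 0 < t^-1 by rewrite invr_gt0.
have d0 := ler0n R d.
rewrite profile_areaE -[d.+1%:R]natr1.
rewrite mulrDl mul1r; apply: lerD; last exact: le_trans h4 h1.
apply: (@le_trans _ _ (d%:R / 2 * t^-1)); last by nra.
by rewrite ler_wpM2l // divr_ge0.
Qed.

(** The tangent inequality taken at both endpoints traps the difference quotient between two values
    of [- profile], which differ by at most [|h|]. *)
Lemma is_derive_profile_area t : is_derive t (1 : R) profile_area (- profile t).
Proof.
have H : h^-1 *: (profile_area (h *: (1 : R) + t) - profile_area t)
    @[h --> (0 : R)^'] --> - profile t.
  apply/cvgrPdist_le => e e0; near=> h.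
  have h0 : h != 0 by near: h; exact: nbhs_dnbhs_neq.
  have he : `|h| <= e.
    near: h; apply: dnbhs0_le => //.
  rewrite [h *: 1]mulr1 [_ *: _]mulrC.
  have aux (A B p q : R) : A - B <= q * (t - (h + t)) ->
      B - A <= p * (h + t - t) -> `|q - p| <= `|h| ->
      `|- p - (A - B) / h| <= e.
    move=> h1 h2 h3; have hp : 0 < `|h| by rewrite normr_gt0.
    rewrite -(ler_pM2r hp) -normrM mulrBl divfK // mulNr -opprD normrN.
    apply: (@le_trans _ _ (`|q - p| * `|h|)).
      rewrite -normrM -[leRHS]normrN ger0_norm; last by lra.
      by apply: le_trans (ler_norm _); lra.
    by rewrite ler_pM2r //; exact: le_trans h3 he.
  apply: aux; [exact: profile_area_tangent..|].
  by apply: le_trans (profile_dist _ _) _; rewrite addrK.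
by apply: DeriveDef; [exact: cvgP H|exact: cvg_lim H].
Unshelve. all: by end_near. Qed.

End Profile.

(** * Partitions with differences at least d *)

Section DiffPartitions.
Variable d : nat.
Hypothesis d_gt0 : (0 < d)%N.

Definition diff_part (lam : seq nat) : bool :=
  is_partition lam && sorted (fun a b => b + d <= a)%N lam.

Lemma diff_part_cons x lam : diff_part (x :: lam) =
  [&& (0 < x)%N, all (fun b => b + d <= x)%N lam & diff_part lam].
Proof.
rewrite /diff_part /is_partition /= !path_sortedE; last 2 first.
- by move=> a b c; lia.
- by move=> a b c; lia.
rewrite inE negb_or eq_sym -lt0n.
apply/idP/idP => [/andP[/andP[/andP[h1 h2] /andP[h3 h4]] /andP[h5 h6]]|].
  by rewrite h2 h3 h4 h5 h6.
move=> /and3P[h1 h2 /andP[/andP[h3 h4] h5]]; rewrite h1 h2 h3 h4 h5 !andbT.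
by apply: sub_all h2 => b; lia.
Qed.

(** Enumerates the partitions of the class with parts at most [P], splitting on whether [P] occurs.
    [k] is fuel, as the call at [P - d] is not structural. *)
Fixpoint diff_parts_rec (k P : nat) : seq (seq nat) :=
  if k is k'.+1 then
    if P is P'.+1 then
      diff_parts_rec k' P' ++ [seq P :: lam | lam <- diff_parts_rec k' (P - d)]
    else [:: [::]]
  else [:: [::]].

Definition diff_parts (P : nat) := diff_parts_rec P P.

Lemma diff_parts_rec_fuel k k' P : (P <= k)%N -> (P <= k')%N ->
  diff_parts_rec k P = diff_parts_rec k' P.
Proof.
elim: k k' P => [|k IH] [|k'] [|P] //= Pk Pk'.
by rewrite (IH k' P) ?(IH k' (P.+1 - d)%N) //; lia.
Qed.

Lemma diff_partsS P : diff_parts P.+1 =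
  diff_parts P ++ [seq P.+1 :: lam | lam <- diff_parts (P.+1 - d)].
Proof.
rewrite /diff_parts [in LHS]/diff_parts_rec -/diff_parts_rec.
by rewrite (@diff_parts_rec_fuel P (P.+1 - d)%N (P.+1 - d)%N) //; lia.
Qed.

Lemma mem_diff_parts P lam :
  (lam \in diff_parts P) = diff_part lam && all (leq^~ P) lam.
Proof.
elim/ltn_ind: P lam => -[|P] IH lam.
  case: lam => [|x lam] //=; rewrite inE /= diff_part_cons.
  by case: x => [|x]; rewrite ?andbF.
rewrite diff_partsS mem_cat IH //.
case: lam => [|x lam]; first by [].
have -> : (x :: lam \in [seq P.+1 :: l | l <- diff_parts (P.+1 - d)]) =
    (x == P.+1) && (lam \in diff_parts (P.+1 - d)).
  apply/mapP/andP => [[l lP [-> ->]]|[/eqP-> lP]]; first by rewrite eqxx.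
  by exists lam.
rewrite IH; last lia.
rewrite diff_part_cons /=.
have [->|xP] := eqVneq x P.+1; last first.
  rewrite /= orbF; case: diff_part; rewrite ?andbF // !andbT.
  case: (ltnP x P.+1) => xP'.
    have xP1 : (x <= P)%N by lia.
    rewrite xP1 (leqW xP1) /=.
    case h : ((0 < x)%N && _) => //=; move/andP: h => [_ h].
    have hh : all (leq^~ P) lam by apply: sub_all h => b; lia.
    by rewrite hh; apply/esym; apply: sub_all hh => b; lia.
  have -> : (x <= P)%N = false by lia.
  have -> : (x <= P.+1)%N = false by lia.
  by rewrite !andbF.
rewrite ltnn andbF leqnn /=.
have [dl|] := boolP (diff_part lam); last by rewrite !andbF.
rewrite andbT /=.
(* The subtraction may truncate to 0; the two conditions still agree because parts are nonzero. *)
have -> : all (fun b => b + d <= P.+1)%N lam = all (leq^~ (P.+1 - d)%N) lam.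
  apply: eq_in_all => b bl; have : b != 0%N.
    apply/eqP => b0; move: dl; rewrite /diff_part /is_partition -b0 bl.
    by rewrite andbF.
  lia.
by case: allP => //= h; apply/esym/allP => b /h; lia.
Qed.

Lemma diff_parts_uniq P : uniq (diff_parts P).
Proof.
elim/ltn_ind: P => -[|P] IH //.
rewrite diff_partsS cat_uniq IH //= map_inj_uniq; last by move=> ? ? [].
rewrite IH ?andbT; last lia.
apply/hasPn => _ /mapP[l _ ->].
by rewrite mem_diff_parts /= ltnn andbF.
Qed.

Lemma sumn_diff_parts P lam : lam \in diff_parts P -> (sumn lam <= P * P)%N.
Proof.
elim/ltn_ind: P lam => -[|P] IH lam; first by rewrite inE => /eqP->.
rewrite diff_partsS mem_cat => /orP[/IH|/mapP[l lP ->]] /=.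
  by move=> /(_ (ltnSn P)); nia.
have /IH/(_ l lP) : (P.+1 - d < P.+1)%N by lia.
by move: (sumn l) => m; nia.
Qed.

Definition sized_diff_parts n := [seq lam <- diff_parts n | sumn lam == n].

Lemma mem_sized_diff_parts n lam :
  (lam \in sized_diff_parts n) = diff_part lam && (sumn lam == n).
Proof.
rewrite mem_filter mem_diff_parts andbC.
have [<-|] := eqVneq (sumn lam) n; last by rewrite !andbF.
rewrite !andbT; case: diff_part => //=.
elim: lam => [|x lam IH] //=; rewrite leq_addr /=.
by apply: sub_all IH => b; lia.
Qed.

Lemma sized_diff_parts_uniq n : uniq (sized_diff_parts n).
Proof. exact/filter_uniq/diff_parts_uniq. Qed.

(** Raising the largest part only widens a gap and adds one to the size; this injection makes the
    counts monotone in the size. *)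
Definition incr_largest (lam : seq nat) :=
  if lam is x :: lam' then x.+1 :: lam' else [:: 1%N].

Lemma size_sized_diff_partsS n :
  (size (sized_diff_parts n) <= size (sized_diff_parts n.+1))%N.
Proof.
rewrite -(size_map incr_largest); apply: uniq_leq_size.
  (* The only possible collision is with the image [[:: 1]] of the empty partition, whose other
     preimage would contain the part 0. *)
  rewrite map_inj_in_uniq ?sized_diff_parts_uniq //.
  move=> [|x l] [|y m]; rewrite !mem_sized_diff_parts //= diff_part_cons.
  - by move=> _ /andP[/and3P[y0 _ _] _] [y1]; lia.
  - by move=> /andP[/and3P[y0 _ _] _] _ [y1]; lia.
  - by move=> _ _ [-> ->].
move=> _ /mapP[[|x l] + ->]; rewrite !mem_sized_diff_parts /=.
  by move=> /eqP<-.
rewrite !diff_part_cons => /andP[/and3P[x0 h1 ->] /eqP<-].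
rewrite addSn eqxx !andbT /=.
by apply: sub_all h1 => b; lia.
Qed.

Lemma leq_size_sized_diff_parts m n : (m <= n)%N ->
  (size (sized_diff_parts m) <= size (sized_diff_parts n))%N.
Proof.
elim: n => [|n IH]; first by rewrite leqn0 => /eqP->.
rewrite leq_eqVlt ltnS => /predU1P[->//|/IH h].
exact: leq_trans h (size_sized_diff_partsS n).
Qed.

Lemma size_sized_diff_parts_gt0 n : (0 < size (sized_diff_parts n))%N.
Proof. exact: leq_trans (leq_size_sized_diff_parts (leq0n n)). Qed.

Lemma uniform_prob_diff (R : realType) n (E : set (seq nat)) :
  Defs.uniform_prob (partitions_diff d) n E =
  (count (fun lam => `[< E lam >]) (sized_diff_parts n))%:R /
  (size (sized_diff_parts n))%:R :> R.
Proof.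
(* [fset_set] has a default value on infinite sets, so each set is first presented as the members of
   a duplicate-free list. *)
have H (Q : pred (seq nat)) (A : set (seq nat)) :
    A = [set lam | lam \in [seq l <- sized_diff_parts n | Q l]] ->
    #|` fset_set A| = count Q (sized_diff_parts n).
  move=> ->; rewrite -size_filter.
  have u : uniq [seq l <- sized_diff_parts n | Q l].
    exact/filter_uniq/sized_diff_parts_uniq.
  rewrite -[in RHS](undup_id u) -card_fseq; congr #|` _|.
  rewrite -[RHS]set_fsetK; congr fset_set.
  by apply/seteqP; split => l /=; rewrite !inE.
have mS lam : of_size (partitions_diff d) n lam <-> lam \in sized_diff_parts n.
  rewrite mem_sized_diff_parts /diff_part; split.
    by move=> [[-> ->] /= ->]; rewrite eqxx.
  by by move=> /andP[/andP[h1 h2] /eqP h3].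
rewrite /Defs.uniform_prob; congr (_%:R / _%:R).
  apply: H; apply/seteqP; split => l /=; rewrite mem_filter.
    by move=> [/mS-> El]; rewrite andbT; apply/asboolP.
  by move=> /andP[/asboolP El /mS].
rewrite -[RHS]count_predT; apply: H; apply/seteqP; split => l /=; rewrite mem_filter.
  by move=> /mS->.
by move=> /mS.
Qed.

(** * Weighted generating functions of the class *)

Section Weights.
Variable R : realType.
Implicit Types (a f : nat -> R) (s : R).

Definition diff_gf a P : R := \sum_(lam <- diff_parts P) \prod_(p <- lam) a p.

Lemma diff_gf0 a : diff_gf a 0 = 1.
Proof. by rewrite /diff_gf big_seq1 big_nil. Qed.

Lemma diff_gfS a P :
  diff_gf a P.+1 = diff_gf a P + a P.+1 * diff_gf a (P.+1 - d).
Proof.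
rewrite /diff_gf diff_partsS big_cat big_map /= big_distrr /=.
by congr +%R; apply: eq_bigr => l _; rewrite big_cons.
Qed.

(** Grouping by size; only an inequality, since a partition of [m] may have parts exceeding [P]. *)
Lemma sum_diff_parts_le f P : (forall n, 0 <= f n) ->
  \sum_(lam <- diff_parts P) f (sumn lam) <=
  \sum_(m < (P * P).+1) (size (sized_diff_parts m))%:R * f m.
Proof.
move=> f0.
have -> : \sum_(lam <- diff_parts P) f (sumn lam) =
    \sum_(lam <- diff_parts P) \sum_(m < (P * P).+1) (sumn lam == m)%:R * f m.
  apply: eq_big_seq => l /sumn_diff_parts; rewrite -ltnS => lP.
  rewrite (bigD1 (Ordinal lP)) //= eqxx mul1r big1 ?addr0 // => m mP.
  have -> : (sumn l == m) = false by apply: contraNF mP => /eqP h; apply/eqP/val_inj.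
  by rewrite mul0r.
rewrite exchange_big /=; apply: ler_sum => m _.
rewrite -mulr_suml ler_wpM2r //.
rewrite -natr_sum ler_nat.
have -> : (\sum_(l <- diff_parts P) (sumn l == m :> nat))%N =
    size [seq l <- diff_parts P | sumn l == m :> nat].
  by rewrite size_filter -sum1_count [RHS]big_mkcond /=; apply: eq_bigr => l _; case: eqP.
apply: uniq_leq_size; first exact/filter_uniq/diff_parts_uniq.
move=> l; rewrite mem_filter mem_sized_diff_parts mem_diff_parts.
by move=> /and3P[-> ->].
Qed.

Lemma prod_expR_sumn s lam :
  \prod_(p <- lam) expR (- (s * p%:R)) = expR (- (s * (sumn lam)%:R)).
Proof.
elim: lam => [|x l IH]; first by rewrite big_nil mulr0 oppr0 expR0.
by rewrite big_cons IH -expRD natrD; congr expR; ring.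
Qed.

End Weights.
End DiffPartitions.

(** * Bounds on the generating function *)

Section Estimates.
Variables (R : realType) (d : nat).
Hypothesis d_gt0 : (0 < d)%N.
Notation g := (@profile R d d_gt0).
Notation G := (@profile_area R d d_gt0).
Implicit Types s t x theta X B : R.

Lemma profile_area_anti x t : x <= t -> G t <= G x.
Proof.
move=> xt; rewrite -subr_le0; apply: le_trans (profile_area_tangent _ _ _) _.
by rewrite pmulr_rle0 ?profile_gt0 // subr_le0.
Qed.

(** [s] times the logarithm of the supersolution when parts from [X] on carry an extra [expR theta]:
    their energy becomes [s * x - theta], and [B] pays for the jump at [X]. *)
Definition tilted_exponent s theta X B x : R :=
  if x < X then G (- (s * d%:R)) - G (s * x)
  else G (- (s * d%:R)) + B - G (s * x - theta).

(* [profile_area] is convex with derivative [- profile], so with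
   [u = expR (- profile h)] moving [j] steps back costs at least a factor [u ^+ j];
   the saddle equation [u + expR (- h) * u ^+ d = 1] closes the induction. *)
Lemma diff_gf_tilted_le s theta X B : 0 < s -> 0 < X ->
  (forall x, X - d%:R <= x < X -> G (s * x - theta) - G (s * x) <= B) ->
  forall P, diff_gf d (fun p => expR (- (s * p%:R) + theta * (X <= p%:R)%R%:R)) P <=
    expR (tilted_exponent s theta X B P%:R / s).
Proof.
move=> s0 X0 HB; elim/ltn_ind => -[|P] IH.
  rewrite diff_gf0 -expR0 ler_expR /tilted_exponent X0 divr_ge0 ?(ltW s0) //.
  by rewrite subr_ge0 mulr0 profile_area_anti // oppr_le0 mulr_ge0 ?(ltW s0).
rewrite diff_gfS //.
set a := fun p : nat => expR _ : R; set V := tilted_exponent s theta X B.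
pose p : R := P.+1%:R; pose h := s * p - theta * (X <= p)%R%:R.
have aE : a P.+1 = expR (- h) by rewrite /a /h; congr expR; rewrite opprB addrC.
have Vback j : (0 < j <= d)%N -> V (p - j%:R) <= V p - s * j%:R * g h.
  move=> /andP[j0 jd].
  have jR : 0 < j%:R :> R by rewrite ltr0n.
  have jdR : j%:R <= d%:R :> R by rewrite ler_nat.
  rewrite /V /tilted_exponent /h.
  case: (ltP p X) => pX.
    have -> : p - j%:R < X by lra.
    have := profile_area_tangent d_gt0 (s * p) (s * (p - j%:R)).
    rewrite mulr0 subr0 [s * (p - _) - s * p](_ : _ = - (s * j%:R)); last by ring.
    by rewrite mulrN [g _ * _]mulrC; lra.
  rewrite mulr1.
  have := profile_area_tangent d_gt0 (s * p - theta) (s * (p - j%:R) - theta).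
  rewrite [s * (p - _) - _ - _](_ : _ = - (s * j%:R)); last by ring.
  rewrite mulrN [g _ * _]mulrC => T.
  case: (ltP (p - j%:R) X) => pjX; last by lra.
  have := HB (p - j%:R); rewrite pjX andbT => /(_ ltac:(lra)); lra.
have back j : (0 < j <= d)%N ->
    diff_gf d a (P.+1 - j) <= expR (V p / s) * expR (- g h) ^+ j.
  move=> jd; have /andP[j0 jd'] := jd.
  apply: (@le_trans _ _ (expR (V (p - j%:R) / s))); last first.
    rewrite -expRM_natl -expRD ler_expR.
    have -> : V p / s + j%:R * - g h = (V p - s * j%:R * g h) / s.
      by field; lra.
    by rewrite ler_pM2r ?invr_gt0 //; exact: Vback.
  have [jP|jP] := leqP j P.+1.
    by rewrite -natrB //; apply: IH; lia.
  (* The index truncates to 0 while [p - j] lies between [- d] and 0; the offset [G (- (s * d))]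
     keeps the exponent nonnegative there. *)
  have -> : (P.+1 - j = 0)%N by lia.
  have jPR : p < j%:R by rewrite ltr_nat.
  have jdR : j%:R <= d%:R :> R by rewrite ler_nat.
  have p0 : 0 <= p by [].
  rewrite diff_gf0 -[leLHS]expR0 ler_expR divr_ge0 ?(ltW s0) //.
  rewrite /V /tilted_exponent.
  have -> : p - j%:R < X by lra.
  by rewrite subr_ge0 profile_area_anti // -mulrN ler_pM2l //; lra.
have [_ gE] := profileP d_gt0 h.
apply: (@le_trans _ _ (expR (V p / s) *
    (expR (- g h) + expR (- h) * expR (- g h) ^+ d))); last by rewrite gE mulr1.
rewrite mulrDr; apply: lerD.
  by have := back 1%N; rewrite subn1 /= expr1; apply.
rewrite -[expR (- (s * _) + _)]/(a P.+1) aE mulrCA ler_pM2l ?expR_gt0 //.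
by apply: back; rewrite d_gt0 leqnn.
Qed.

Lemma diff_gf_le s P : 0 < s ->
  diff_gf d (fun p => expR (- (s * p%:R))) P <= expR (G (- (s * d%:R)) / s).
Proof.
move=> s0.
(* No tilt, and a threshold beyond every part considered. *)
have := @diff_gf_tilted_le s 0 P.+1%:R 0 s0 _ _ P.
rewrite ltr0n => /(_ isT) H.
have {H} := H (fun x _ => ltac:(by rewrite subr0 subrr)).
rewrite /tilted_exponent ltr_nat ltnSn.
under [X in diff_gf d X]funext do rewrite mul0r addr0.
move=> H; apply: le_trans H _; rewrite ler_expR ler_pM2r ?invr_gt0 //.
by have := profile_area_ge0 d_gt0 (s * P%:R); lra.
Qed.

(** Mirror image of the upper bound: after the shift by [d], stepping back at most [d] stays to the
    right of [s * p], where the slope of [G] is at most [g (s * p)] in absolute value. *)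
Lemma diff_gf_ge s P : 0 < s ->
  expR ((G (s * d%:R) - G (s * (P%:R + d%:R))) / s) <=
  diff_gf d (fun p => expR (- (s * p%:R))) P.
Proof.
move=> s0; elim/ltn_ind: P => -[|P] IH.
  by rewrite diff_gf0 add0r subrr mul0r expR0.
rewrite diff_gfS //.
set a := fun p : nat => expR _ : R.
pose p : R := P.+1%:R; pose V x := G (s * d%:R) - G (s * (x + d%:R)).
have Vback j : (0 < j <= d)%N -> V p - s * j%:R * g (s * p) <= V (p - j%:R).
  move=> /andP[j0 jd].
  have jR : 0 <= s * j%:R :> R by rewrite mulr_ge0 ?(ltW s0).
  have jdR : j%:R <= d%:R :> R by rewrite ler_nat.
  have := profile_area_tangent d_gt0 (s * (p - j%:R + d%:R)) (s * (p + d%:R)).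
  rewrite [s * (p + d%:R) - s * _](_ : _ = s * j%:R); last by ring.
  have : g (s * (p - j%:R + d%:R)) <= g (s * p).
    by apply: profile_anti; rewrite ler_pM2l //; lra.
  move=> /(ler_wpM2r jR); rewrite /V [s * j%:R * _]mulrC; lra.
have back j : (0 < j <= d)%N ->
    expR (V p / s) * expR (- g (s * p)) ^+ j <= diff_gf d a (P.+1 - j).
  move=> jd; have /andP[j0 jd'] := jd.
  apply: (@le_trans _ _ (expR (V (p - j%:R) / s))).
    rewrite -expRM_natl -expRD ler_expR.
    have -> : V p / s + j%:R * - g (s * p) = (V p - s * j%:R * g (s * p)) / s.
      by field; lra.
    by rewrite ler_pM2r ?invr_gt0 //; exact: Vback.
  have [jP|jP] := leqP j P.+1.
    by rewrite -natrB //; apply: IH; lia.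
  have -> : (P.+1 - j = 0)%N by lia.
  have jPR : p < j%:R by rewrite ltr_nat.
  (* In the truncated case [V] is nonpositive, so the initial value 1 dominates. *)
  rewrite diff_gf0 expR_le1 pmulr_lle0 ?invr_gt0 //.
  by rewrite subr_le0 profile_area_anti // ler_pM2l //; lra.
have [_ gE] := profileP d_gt0 (s * p).
apply: (@le_trans _ _ (expR (V p / s) *
    (expR (- g (s * p)) + expR (- (s * p)) * expR (- g (s * p)) ^+ d))).
  by rewrite gE mulr1.
rewrite mulrDr; apply: lerD.
  by have := back 1%N; rewrite subn1 /= expr1; apply.
rewrite mulrCA ler_pM2l ?expR_gt0 //.
by apply: back; rewrite d_gt0 leqnn.
Qed.

(** Markov's inequality in counting form, the basis of the Chernoff bounds. *)
Lemma count_sized_le (Q : pred (seq nat)) (a : nat -> R) (K : R) n :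
  0 <= K -> (forall p, 0 <= a p) ->
  (forall lam, sumn lam = n -> Q lam -> 1 <= K * \prod_(p <- lam) a p) ->
  (count Q (sized_diff_parts d n))%:R <= K * diff_gf d a n.
Proof.
move=> K0 a0 H.
rewrite -sum1_count natr_sum /diff_gf mulr_sumr big_filter_cond.
rewrite big_mkcond /=; apply: ler_sum => l _.
case: ifPn => [/andP[/eqP ln Ql]|_]; first exact: H.
by rewrite mulr_ge0 // prodr_ge0.
Qed.

(** The tangent and Lipschitz bounds show that the lattice offset [s * d] costs a constant
    independent of [s]. *)
Lemma profile_area_opp_le s : 0 < s <= 1 ->
  G (- (s * d%:R)) / s <= G 0 / s + (d%:R * g 0 + d%:R ^+ 2).
Proof.
move=> /andP[s0 s1].
have d0 := ler0n R d.
have sd0 : 0 <= s * d%:R by rewrite mulr_ge0 // ltW.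
have h1 := profile_area_tangent d_gt0 (- (s * d%:R)) 0.
have h2 : g (- (s * d%:R)) - g 0 <= 0 - - (s * d%:R).
  by apply: profile_lipschitz; lra.
rewrite sub0r opprK in h1 h2.
rewrite ler_pdivrMr // mulrDl divfK ?gt_eqF //.
have h3 : g (- (s * d%:R)) * (s * d%:R) <= (g 0 + s * d%:R) * (s * d%:R).
  by rewrite ler_wpM2r //; lra.
have h4 : s * d%:R * (s * d%:R) <= d%:R ^+ 2 * s.
  have : 0 <= d%:R ^+ 2 * s * (1 - s) by rewrite !mulr_ge0 ?sqr_ge0 //; lra.
  lra.
lra.
Qed.

Lemma size_sized_le s n : 0 < s <= 1 ->
  (size (sized_diff_parts d n))%:R * expR (- (s * n%:R)) <=
  expR (G 0 / s + (d%:R * g 0 + d%:R ^+ 2)).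
Proof.
move=> s01; have /andP[s0 _] := s01.
apply: (@le_trans _ _ (expR (G (- (s * d%:R)) / s))); last first.
  by rewrite ler_expR profile_area_opp_le.
apply: le_trans (diff_gf_le n s0).
have := @count_sized_le predT (fun p => expR (- (s * p%:R))) (expR (s * n%:R)) n.
rewrite count_predT expR_ge0 => /(_ isT (fun p => expR_ge0 _)) H.
rewrite expRN ler_pdivrMr ?expR_gt0 // mulrC; apply: H => l <- _.
by rewrite prod_expR_sumn -expRD subrr expR0.
Qed.

(** The tangent at 0 handles [G (s * d)] and the decay of [G] the tail; for [s] of order
    [1 / sqrt n] both errors are bounded. *)
Lemma diff_gf_ge_explicit s n : 0 < s -> (0 < n)%N ->
  expR (G 0 / s - d%:R * g 0 - d.+1%:R / (s ^+ 2 * n%:R)) <=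
  diff_gf d (fun p => expR (- (s * p%:R))) n.
Proof.
move=> s0 n0; apply: le_trans (diff_gf_ge n s0); rewrite ler_expR.
have nR : 0 < n%:R :> R by rewrite ltr0n.
have h1 := profile_area_tangent d_gt0 0 (s * d%:R); rewrite subr0 in h1.
have h2 : G (s * (n%:R + d%:R)) <= d.+1%:R / (s * n%:R).
  apply: (@le_trans _ _ (G (s * n%:R))).
    by apply: profile_area_anti; rewrite ler_pM2l // lerDl.
  by apply: profile_area_le; rewrite mulr_gt0.
rewrite ler_pdivlMr // !mulrBl divfK ?gt_eqF //.
have -> : d.+1%:R / (s ^+ 2 * n%:R) * s = d.+1%:R / (s * n%:R) :> R.
  by field; rewrite !gt_eqF.
lra.
Qed.

End Estimates.

(** Absorbs the number of possible sizes: the left side has degree 4 in [sqrt n], and the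
    exponential exceeds its term of degree 5. *)
Lemma near_poly_le_expR (R : realType) (k C : R) : 0 < k ->
  \forall n \near \oo, C * (n * n).+1%:R <= expR (k * Num.sqrt n%:R).
Proof.
move=> k0.
wlog C0 : C / 0 <= C.
  move=> H; have := H `|C| (normr_ge0 _); apply: filterS => n.
  by apply: le_trans; rewrite ler_wpM2r // ler_norm.
(* [240] is twice [5!]: from [v = M] on, [(k * v) ^+ 5 / 5!] is at least [2 * C * v ^+ 4]. *)
pose M := 240%:R * C / k ^+ 5.
have M0 : 0 <= M by rewrite divr_ge0 ?mulr_ge0 ?exprn_ge0 // ltW.
near=> n.
have n1 : (1 <= n)%N by near: n; exact: nbhs_infty_ge.
have nR : 1 <= n%:R :> R by rewrite ler1n.
set v := Num.sqrt n%:R.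
have vE : v ^+ 2 = n%:R by rewrite sqr_sqrtr.
have v0 : 0 <= v by exact: sqrtr_ge0.
have vM : M <= v.
  rewrite -(@ler_pXn2r _ 2) // vE; near: n; exact: nbhs_infty_ger.
have kv : 0 <= k * v by rewrite mulr_ge0 // ltW.
have := @expR_ge1Dxn R (k * v) 4 kv.
apply: le_trans.
have f5 : 5`!%:R = 120 :> R by [].
rewrite f5 -natr1 natrM -vE.
have v1 : 1 <= v ^+ 2 by rewrite vE.
have h1 : C * (v ^+ 2 * v ^+ 2 + 1) <= 2 * C * v ^+ 4.
  have -> : v ^+ 2 * v ^+ 2 = v ^+ 4 by ring.
  have : 1 <= v ^+ 4 by rewrite -[4%N]/(2 * 2)%N exprM exprn_ege1.
  move=> h; have := ler_wpM2l C0 h; lra.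
have h2 : 2 * C * v ^+ 4 <= (k * v) ^+ 5 / 120.
  have -> : (k * v) ^+ 5 / 120 = (k ^+ 5 / 120 * v) * v ^+ 4 by ring.
  rewrite ler_wpM2r ?exprn_ge0 //.
  have k5 : 0 < k ^+ 5 by rewrite exprn_gt0.
  have : k ^+ 5 / 120 * M <= k ^+ 5 / 120 * v by rewrite ler_wpM2l // divr_ge0 // ltW.
  apply: le_trans; rewrite /M le_eqVlt; apply/orP; left; apply/eqP.
  by field; rewrite gt_eqF.
lra.
Unshelve. all: by end_near. Qed.

(** * Counting partitions *)

Section Counting.
Variables (R : realType) (d : nat).
Hypothesis d_gt0 : (0 < d)%N.
Notation g := (@profile R d d_gt0).
Notation G := (@profile_area R d d_gt0).
Notation S := (sized_diff_parts d).
Let b := Num.sqrt (G 0).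

Lemma profile_area_gt0 t : 0 < G t.
Proof.
have /andP[u0 u1] := onem_expR_profile d_gt0 t.
rewrite profile_areaE ltr_wpDl //; last first.
  by apply: (lt_le_trans u0); apply: Li2_ge; rewrite (ltW u0).
by rewrite mulr_ge0 ?sqr_ge0 // divr_ge0.
Qed.

Lemma scale_gt0 : 0 < b.
Proof. by rewrite sqrtr_gt0 profile_area_gt0. Qed.

Lemma scale_sqr : b ^+ 2 = G 0.
Proof. by rewrite sqr_sqrtr // profile_area_ge0. Qed.

(* The generating function at [s = (1 + delta) b / sqrt N] is dominated by the
   sizes between [(1 - 3 delta) N] and [N], and the counts are monotone in the size. *)
Lemma size_sized_ge (delta : R) : 0 < delta <= 1 / 4 ->
  \forall n \near \oo,
    expR ((2 - 6 * delta) * b * Num.sqrt n%:R) <= (size (S n))%:R.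
Proof.
move=> /andP[dl0 dl1].
have b0 := scale_gt0.
pose C : R := d%:R * g 0 + d%:R ^+ 2.
pose C1 : R := d%:R * g 0 + d.+1%:R / b ^+ 2.
(* In units of [b * sqrt n]: [E0] is the exponent of the whole generating function, [E3] the decay
   of the weight at the lower edge of the window, and [kap] the margin lost outside the window. *)
pose E0 : R := (1 + delta)^-1; pose E3 := (1 + delta) * (1 - 3 * delta).
pose kap := delta ^+ 3.
have kap0 : 0 < kap by rewrite exprn_gt0.
have dp : 0 < 1 + delta by lra.
have dpp : 0 < 1 + 2 * delta by lra.
have E0E : E0 * (1 + delta) = 1 by rewrite mulVf // gt_eqF.
(* [gap1] treats sizes above the window, [gap2] those below it, and [gap3] the final exponent with a
   spare [delta] for polynomial factors. *)
have gap1 : 1 - delta <= E0 - kap.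
  rewrite lerBrDr -(ler_pM2r dp) E0E /kap.
  have : 0 <= delta ^+ 2 * (1 - delta - delta ^+ 2) by rewrite mulr_ge0 ?sqr_ge0 //; nra.
  lra.
have gap2 : (1 + 2 * delta)^-1 + delta * (1 - 3 * delta) <= E0 - kap.
  have : (1 + 2 * delta)^-1 * (1 + 2 * delta) = 1 by rewrite mulVf // gt_eqF.
  move: (_^-1) => E2 E2E.
  rewrite -(ler_pM2r (mulr_gt0 dp dpp)).
  have -> : (E2 + delta * (1 - 3 * delta)) * ((1 + delta) * (1 + 2 * delta)) =
      E2 * (1 + 2 * delta) * (1 + delta) +
      delta * (1 - 3 * delta) * (1 + delta) * (1 + 2 * delta) by ring.
  have -> : (E0 - kap) * ((1 + delta) * (1 + 2 * delta)) =
      E0 * (1 + delta) * (1 + 2 * delta) - kap * (1 + delta) * (1 + 2 * delta).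
    by ring.
  rewrite E2E E0E /kap.
  have : 0 <= delta ^+ 3 * (6 + 3 * delta - 2 * delta ^+ 2).
    by rewrite mulr_ge0 ?exprn_ge0 ?(ltW dl0) //; nra.
  lra.
have gap3 : 2 - 6 * delta + delta <= E0 + E3.
  rewrite -(ler_pM2r dp) [leRHS]mulrDl E0E /E3.
  have : 0 <= delta * (2 - 3 * delta ^+ 2) by rewrite mulr_ge0 ?(ltW dl0) //; nra.
  lra.
have kb : 0 < kap * b by rewrite mulr_gt0.
have db : 0 < delta * b by rewrite mulr_gt0.
near=> n.
have n1 : (1 <= n)%N by near: n; exact: nbhs_infty_ge.
have nR : 1 <= n%:R :> R by rewrite ler1n.
have near1 : (4 * expR (C + C1)) * (n * n).+1%:R <= expR (kap * b * Num.sqrt n%:R).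
  by near: n; exact: near_poly_le_expR.
have near2 : (2 * expR C1) * (n * n).+1%:R <= expR (delta * b * Num.sqrt n%:R).
  by near: n; exact: near_poly_le_expR.
have nbig : 4 * b ^+ 2 <= n%:R by near: n; exact: nbhs_infty_ger.
set v := Num.sqrt n%:R in near1 near2 *.
have vE : v ^+ 2 = n%:R by rewrite sqr_sqrtr.
have v0 : 0 < v by rewrite sqrtr_gt0; lra.
have vb : 2 * b <= v.
  rewrite -(@ler_pXn2r _ 2) ?nnegrE ?vE ?(ltW v0) //; first by rewrite exprMn -natrX.
  by rewrite mulr_ge0 // ltW.
have in01 (k : R) : 0 < k <= 2 -> 0 < k * b / v <= 1.
  move=> /andP[k0 k2]; rewrite divr_gt0 ?mulr_gt0 //= ler_pdivrMr // mul1r.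
  by apply: le_trans vb; rewrite ler_pM2r.
have bound (k : R) m : 0 < k <= 2 ->
    (size (S m))%:R * expR (- (k * b / v * m%:R)) <= expR (k^-1 * b * v + C).
  move=> k02; have /andP[k0 _] := k02.
  have := size_sized_le d_gt0 m (in01 k k02).
  rewrite -scale_sqr -/C [b ^+ 2 / _](_ : _ = k^-1 * b * v) //.
  by field; rewrite !gt_eqF.
pose s := (1 + delta) * b / v.
have s0 : 0 < s by rewrite divr_gt0 ?mulr_gt0.
(* Sizes off the window are bounded at another parameter: [k = 1] above it, [k = 1 + 2 * delta]
   below it. *)
have splitE m k : expR (- (s * m%:R)) =
    expR (- (k * b / v * m%:R)) * expR ((k - 1 - delta) * b / v * m%:R).
  by rewrite -expRD; congr expR; rewrite /s; ring.
pose T := expR ((E0 - kap) * b * v + C).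
have T0 : 0 <= T by exact: expR_ge0.
pose U := (size (S n))%:R * expR (- (E3 * b * v)) : R.
have U0 : 0 <= U by rewrite mulr_ge0 // expR_ge0.
have term m : (size (S m))%:R * expR (- (s * m%:R)) <= T + U.
  have [nm|mn] := ltnP n m.
    apply: (@le_trans _ _ T); last by rewrite lerDl.
    rewrite (splitE m 1) mulrA.
    apply: (@le_trans _ _ (expR (1^-1 * b * v + C) * expR (- (delta * b * v)))).
      apply: ler_pM; rewrite ?expR_ge0 ?mulr_ge0 ?expR_ge0 //.
        by apply: bound; lra.
      rewrite ler_expR.
      have -> : delta * b * v = delta * b / v * n%:R.
        by rewrite -vE; field; rewrite gt_eqF.
      have -> : 1 - 1 - delta = - delta by ring.
      rewrite !mulNr lerN2 ler_wpM2l ?ler_nat ?(ltnW nm) //.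
      by rewrite divr_ge0 ?ltW.
    rewrite -expRD /T ler_expR invr1 mul1r.
    have : (1 - delta) * (b * v) <= (E0 - kap) * (b * v).
      by rewrite ler_wpM2r // mulr_ge0 // ltW.
    lra.
  have [ml|lm] := leP (m%:R) ((1 - 3 * delta) * n%:R).
    apply: (@le_trans _ _ T); last by rewrite lerDl.
    rewrite (splitE m (1 + 2 * delta)) mulrA.
    apply: (@le_trans _ _ (expR ((1 + 2 * delta)^-1 * b * v + C) *
        expR (delta * (1 - 3 * delta) * b * v))).
      apply: ler_pM; rewrite ?expR_ge0 ?mulr_ge0 ?expR_ge0 //.
        by apply: bound; lra.
      rewrite ler_expR.
      have -> : delta * (1 - 3 * delta) * b * v =
          delta * b / v * ((1 - 3 * delta) * n%:R).
        by rewrite -vE; field; rewrite gt_eqF.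
      have -> : 1 + 2 * delta - 1 - delta = delta by ring.
      by rewrite ler_wpM2l // divr_ge0 ?ltW.
    rewrite -expRD /T ler_expR.
    have : ((1 + 2 * delta)^-1 + delta * (1 - 3 * delta)) * (b * v) <=
        (E0 - kap) * (b * v).
      by rewrite ler_wpM2r // mulr_ge0 // ltW.
    lra.
  apply: (@le_trans _ _ U); last by rewrite lerDr.
  apply: ler_pM; rewrite ?expR_ge0 //.
    by rewrite ler_nat leq_size_sized_diff_parts.
  rewrite ler_expR lerN2.
  have -> : E3 * b * v = s * ((1 - 3 * delta) * n%:R).
    by rewrite /E3 /s -vE; field; rewrite gt_eqF.
  by rewrite ler_pM2l // ltW.
have total : expR (E0 * b * v - C1) <= (n * n).+1%:R * (T + U).
  have L := diff_gf_ge_explicit d_gt0 s0 n1.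
  apply: (@le_trans _ _ (diff_gf d (fun p => expR (- (s * p%:R))) n)).
    apply: le_trans L; rewrite ler_expR.
    have -> : G 0 / s = E0 * b * v.
      by rewrite -scale_sqr /s /E0; field; rewrite !gt_eqF.
    have : d.+1%:R / (s ^+ 2 * n%:R) <= d.+1%:R / b ^+ 2.
      have b20 : 0 < b ^+ 2 by exact: exprn_gt0.
      have s2n0 : 0 < s ^+ 2 * n%:R by apply: mulr_gt0; [exact: exprn_gt0|lra].
      rewrite ler_wpM2l // lef_pV2 ?posrE //.
      have -> : s ^+ 2 * n%:R = (1 + delta) ^+ 2 * b ^+ 2.
        by rewrite /s -vE; field; rewrite gt_eqF.
      by rewrite ler_peMl ?sqr_ge0 // exprn_ege1 //; lra.
    by rewrite /C1; lra.
  rewrite /diff_gf; under eq_bigr do rewrite prod_expR_sumn.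
  apply: le_trans (sum_diff_parts_le d_gt0 n (fun m => expR_ge0 (- (s * m%:R)))) _.
  apply: (@le_trans _ _ (\sum_(m < (n * n).+1) (T + U))).
    by apply: ler_sum => m _; exact: term.
  by rewrite sumr_const card_ord mulr_natl.
(* Sizes off the window contribute at most a quarter of the total, so [U] must carry at least half
   of it. *)
have TE : 4 * ((n * n).+1%:R * T) <= expR (E0 * b * v - C1).
  have -> : expR (E0 * b * v - C1) =
      expR (kap * b * v) * (expR ((E0 - kap) * b * v + C) * expR (- (C + C1))).
    by rewrite -!expRD; congr expR; ring.
  rewrite -/T mulrC.
  apply: (@le_trans _ _ (4 * expR (C + C1) * (n * n).+1%:R * (T * expR (- (C + C1))))).
    rewrite expRN le_eqVlt; apply/orP; left; apply/eqP.
    by field; rewrite gt_eqF // expR_gt0.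
  by rewrite ler_wpM2r // mulr_ge0 // expR_ge0.
have UE : expR (E0 * b * v - C1) <= 2 * ((n * n).+1%:R * U).
  by rewrite mulrDr in total; have := expR_ge0 (E0 * b * v - C1); lra.
have M0 : 0 < (n * n).+1%:R :> R by rewrite ltr0n.
have M20 : 0 < 2 * expR C1 * (n * n).+1%:R by rewrite !mulr_gt0 // expR_gt0.
rewrite -(ler_pM2l M20).
apply: (@le_trans _ _ (expR (delta * b * v) * expR ((2 - 6 * delta) * b * v))).
  by rewrite ler_wpM2r // expR_ge0.
rewrite -expRD.
apply: (@le_trans _ _ (expR (E0 * b * v - C1) * expR (E3 * b * v + C1))).
  rewrite -expRD ler_expR.
  have : (2 - 6 * delta + delta) * (b * v) <= (E0 + E3) * (b * v).
    by rewrite ler_wpM2r // mulr_ge0 // ltW.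
  lra.
apply: le_trans (ler_wpM2r (expR_ge0 _) UE) _.
rewrite /U expRD expRN le_eqVlt; apply/orP; left; apply/eqP.
by field; rewrite gt_eqF // expR_gt0.
Unshelve. all: by end_near. Qed.

(** The complement of the event of [limit_shape] at one point, for [alpha n = sqrt n], where
    [alpha n / n] is [1 / sqrt n]. *)
Definition deviates (n : nat) (t eps : R) : pred (seq nat) := fun lam =>
  eps <= `|(num_parts_ge lam (Num.sqrt n%:R * t))%:R / Num.sqrt n%:R - g (b * t) / b|.

Lemma count_deviates_le (t eps : R) : 0 < t -> 0 < eps ->
  exists C : R, \forall n \near \oo,
    (count (deviates n t eps) (S n))%:R <=
    2 * expR ((2 * b - eps ^+ 2 * b / 4) * Num.sqrt n%:R + C).
Proof.
move=> t0 eps0; have b0 := scale_gt0.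
(* Optimal tilt: it maximizes the gain [eps * v * th0] minus the cost [th0 ^+ 2 * v / b], leaving
   the saving [eps ^+ 2 * b / 4 * v]. *)
pose th0 := eps * b / 2.
have th00 : 0 < th0 by rewrite divr_gt0 ?mulr_gt0.
exists (d%:R * g 0 + d%:R ^+ 2 + th0 * d%:R).
near=> n.
have n1 : (1 <= n)%N by near: n; exact: nbhs_infty_ge.
have nR : 1 <= n%:R :> R by rewrite ler1n.
have nbig : b ^+ 2 <= n%:R by near: n; exact: nbhs_infty_ger.
(* Ensures [X <= n], so that the exponent at [n] is on its tilted branch. *)
have nbig' : t ^+ 2 <= n%:R by near: n; exact: nbhs_infty_ger.
set v := Num.sqrt n%:R.
have vE : v ^+ 2 = n%:R by rewrite sqr_sqrtr.
have v0 : 0 < v by rewrite sqrtr_gt0; lra.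
have bv : b <= v by rewrite -(@ler_pXn2r _ 2) ?nnegrE ?vE ?(ltW v0) ?(ltW b0).
have tv : t <= v by rewrite -(@ler_pXn2r _ 2) ?nnegrE ?vE ?(ltW v0) ?(ltW t0).
pose s := b / v; pose X := v * t.
have s0 : 0 < s by rewrite divr_gt0.
have s01 : 0 < s <= 1 by rewrite s0 ler_pdivrMr // mul1r.
have X0 : 0 < X by rewrite mulr_gt0.
have Xn : X <= n%:R by rewrite -vE expr2 ler_pM2l.
have sX : s * X = b * t by rewrite /s /X; field; rewrite gt_eqF.
have d0 := ler0n R d.
have sided (theta : R) : `|theta| = th0 ->
    (count (fun lam => eps * v * th0 <=
        theta * ((num_parts_ge lam X)%:R - v * (g (b * t) / b))) (S n))%:R <=
    expR ((2 * b - eps ^+ 2 * b / 4) * v +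
      (d%:R * g 0 + d%:R ^+ 2 + th0 * d%:R)).
  move=> thE.
  (* The tangent bound gives [theta * g (s * x - theta)]; since [s * x] is within [s * d] of
     [b * t], the Lipschitz bound replaces the argument by [b * t]. *)
  pose B := theta * g (b * t) + th0 ^+ 2 + th0 * (s * d%:R).
  have HB x : X - d%:R <= x < X -> G (s * x - theta) - G (s * x) <= B.
    move=> /andP[x1 x2].
    apply: le_trans (profile_area_tangent _ _ _) _.
    rewrite subKr [_ * theta]mulrC -[g _](subrK (g (b * t))) mulrDr addrC.
    rewrite /B -addrA lerD2l.
    apply: le_trans (ler_norm _) _; rewrite normrM thE expr2 -mulrDr ler_pM2l //.
    apply: le_trans (profile_dist _ _ _) _; rewrite -sX.
    rewrite (_ : s * x - theta - s * X = - theta + - (s * (X - x))); last by ring.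
    apply: le_trans (ler_normD _ _) _; rewrite !normrN thE lerD2l.
    rewrite ger0_norm; last by rewrite mulr_ge0 ?(ltW s0) //; lra.
    by rewrite ler_pM2l //; lra.
  have L := diff_gf_tilted_le s0 X0 HB n.
  pose a := fun p : nat => expR (- (s * p%:R) + theta * (X <= p%:R)%R%:R) : R.
  pose K := expR (s * n%:R - theta * (v * (g (b * t) / b)) - eps * v * th0).
  have prodE lam : \prod_(p <- lam) a p =
      expR (- (s * (sumn lam)%:R) + theta * (num_parts_ge lam X)%:R).
    elim: lam => [|x l IH]; first by rewrite big_nil !mulr0 addr0 oppr0 expR0.
    rewrite big_cons IH -expRD /= natrD natrD; congr expR; ring.
  apply: (@le_trans _ _ (K * diff_gf d a n)).
    apply: count_sized_le; [exact: expR_ge0|by move=> p; exact: expR_ge0|].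
    move=> lam lamn H; rewrite prodE lamn /K -expRD -[leLHS]expR0 ler_expR.
    by rewrite mulrBr in H; lra.
  apply: le_trans (ler_wpM2l (expR_ge0 _) L) _.
  rewrite -expRD ler_expR /tilted_exponent ltNge Xn /=.
  have H1 := profile_area_opp_le d_gt0 s01.
  have H2 := profile_area_ge0 d_gt0 (s * n%:R - theta).
  have H3 : (G (- (s * d%:R)) + B - G (s * n%:R - theta)) / s <=
      G (- (s * d%:R)) / s + B / s.
    by rewrite -mulrDl ler_pM2r ?invr_gt0 //; lra.
  have e1 : s * n%:R = b * v by rewrite /s -vE; field; rewrite gt_eqF.
  have e2 : G 0 / s = b * v.
    by rewrite -scale_sqr /s; field; rewrite !gt_eqF.
  have e3 : B / s = theta * (v * (g (b * t) / b)) + eps ^+ 2 * b / 4 * v + th0 * d%:R.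
    by rewrite /B /th0 /s; field; rewrite !gt_eqF.
  have e4 : eps * v * th0 = 2 * (eps ^+ 2 * b / 4 * v).
    by rewrite /th0; field.
  rewrite e2 in H1; rewrite e1 e3 in H3; rewrite e1 e4; lra.
(* The positive tilt catches an excess of large parts, the negative one a deficit. *)
have H1 := sided th0 (gtr0_norm th00).
have H2 := sided (- th0) (etrans (normrN _) (gtr0_norm th00)).
rewrite mulr2n mulrDl mul1r.
apply: le_trans (lerD H1 H2).
rewrite -natrD ler_nat -count_predUI.
apply: leq_trans (leq_addr _ _); apply: sub_count => lam /=.
rewrite /deviates -/v -/X.
set N := (num_parts_ge lam X)%:R : R; set p := g (b * t) / b.
have -> : N / v - p = (N - v * p) / v by field; rewrite gt_eqF.
rewrite normrM normfV (gtr0_norm v0) ler_pdivlMr // => H.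
have : eps * v * th0 <= `|N - v * p| * th0 by rewrite ler_pM2r.
case: (ger0P (N - v * p)) => _ h; apply/orP; [left|right].
  by rewrite mulrC in h *; rewrite [th0 * _]mulrC; lra.
by lra.
Unshelve. all: by end_near. Qed.

Lemma deviates_prob_cvg (t eps : R) : 0 < t -> 0 < eps ->
  (count (deviates n t eps) (S n))%:R / (size (S n))%:R @[n --> \oo] --> (0 : R).
Proof.
move=> t0 eps0; have b0 := scale_gt0.
have [C HC] := count_deviates_le t0 eps0.
(* Makes the loss [6 * delta * b] at most half of the saving [eps ^+ 2 * b / 4]; the other half is
   [k] below. *)
pose delta := Num.min (1 / 4) (eps ^+ 2 / 48).
have e2 : 0 < eps ^+ 2 by rewrite exprn_gt0.
have dl0 : 0 < delta by rewrite lt_min; apply/andP; split; lra.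
have dl1 : delta <= 1 / 4 by rewrite ge_min lexx.
have dl2 : delta <= eps ^+ 2 / 48 by rewrite ge_min lexx orbT.
have Hs := @size_sized_ge delta; rewrite dl0 dl1 in Hs; move/(_ isT) in Hs.
pose k := eps ^+ 2 * b / 8.
have k0 : 0 < k by rewrite divr_gt0 ?mulr_gt0.
apply/cvgrPdist_le => e e0; near=> n.
have SR : 0 < (size (S n))%:R :> R.
  by rewrite ltr0n size_sized_diff_parts_gt0.
rewrite sub0r normrN ger0_norm ?divr_ge0 // ler_pdivrMr //.
have h1 : (count (deviates n t eps) (S n))%:R <=
    2 * expR ((2 * b - eps ^+ 2 * b / 4) * Num.sqrt n%:R + C).
  by near: n; exact: HC.
have h2 : expR ((2 - 6 * delta) * b * Num.sqrt n%:R) <= (size (S n))%:R.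
  by near: n; exact: Hs.
have h3 : 2 * expR C / e * (n * n).+1%:R <= expR (k * Num.sqrt n%:R).
  by near: n; exact: near_poly_le_expR.
have v0 : 0 <= Num.sqrt n%:R :> R by exact: sqrtr_ge0.
move: (Num.sqrt n%:R) v0 h1 h2 h3 => v v0 h1 h2 h3.
apply: le_trans h1 _; apply: le_trans (ler_wpM2l (ltW e0) h2).
have h4 : 2 * expR C <= e * expR (k * v).
  rewrite [leRHS]mulrC -ler_pdivrMr //; apply: le_trans h3.
  by rewrite ler_peMr ?ler1n // divr_ge0 ?mulr_ge0 ?expR_ge0 // ltW.
rewrite expRD mulrCA.
apply: le_trans (ler_wpM2l (expR_ge0 _) h4) _.
rewrite mulrCA ler_pM2l // -expRD ler_expR /k.
have := ler_wpM2r (mulr_ge0 (ltW b0) v0) dl2; lra.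
Unshelve. all: by end_near. Qed.

End Counting.

(** * The limit shape *)

Lemma count_has_le (T U : Type) (D : T -> pred U) (ts : seq T) (s : seq U) :
  (count (fun x => has (D^~ x) ts) s <= \sum_(t <- ts) count (D t) s)%N.
Proof.
elim: ts => [|t ts IH]; first by rewrite big_nil count_pred0.
rewrite big_cons; apply: leq_trans (leq_add (leqnn _) IH).
by rewrite -count_predUI leq_addr.
Qed.

Lemma sub_in_count (T : eqType) (a1 a2 : pred T) (s : seq T) :
  {in s, subpred a1 a2} -> (count a1 s <= count a2 s)%N.
Proof.
move=> a12; rewrite -!sum1_count big_mkcond [leqRHS]big_mkcond.
rewrite big_seq [leqRHS]big_seq; apply: leq_sum => x xs.
by case: ifP => // a1x; rewrite (a12 x xs a1x).
Qed.

Section LimitShape.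
Variables (R : realType) (d : nat).
Hypothesis d_gt0 : (0 < d)%N.
Notation g := (@profile R d d_gt0).
Notation G := (@profile_area R d d_gt0).
Notation S := (sized_diff_parts d).
Notation sqrtn := (fun n : nat => Num.sqrt (n%:R : R)).
Let b := Num.sqrt (G 0).

Let b_gt0 : 0 < b := scale_gt0 R d_gt0.

(** The area under [g] on the half-line is [G 0 = b ^+ 2]; dividing both axes by [b] normalizes it
    to 1. *)
Definition shape (t : R) : R := g (b * t) / b.

Lemma continuous_shape : continuous shape.
Proof.
move=> t; apply: cvgMl.
apply: continuous_comp; last exact: continuous_profile.
exact: mulrl_continuous.
Qed.

Lemma shape_ge0 t : 0 <= shape t.
Proof. by rewrite divr_ge0 ?ltW ?profile_gt0. Qed.

Lemma piecewise_continuous_shape : piecewise_continuous shape.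
Proof.
split => [x y x0|t t0].
  rewrite (_ : [set t | _] = set0); first exact: finite_set0.
  by apply/seteqP; split => // t [_ /(_ (@continuous_shape t))].
split; apply: cvgP.
  exact: cvg_at_left_filter (@continuous_shape t).
exact: cvg_at_right_filter (@continuous_shape t).
Qed.

(** [F] is an antiderivative with value -1 at 0 and limit 0 at infinity. *)
Lemma integral_shape :
  (\int[lebesgue_measure]_(t in `]0%R, +oo[) (shape t)%:E = 1)%E.
Proof.
pose F (t : R) := - (b ^+ 2)^-1 * G (b * t).
have b2 : 0 < b ^+ 2 by rewrite exprn_gt0.
have dF (t : R) : is_derive t (1 : R) F (shape t).
  have h : is_derive t (1 : R) (fun t : R => b * t) b.
    by apply: is_derive_eq; rewrite [_%:A]mulr1.
  have hG := @is_derive_profile_area R d d_gt0 (b * t).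
  have hc := @is_derive1_comp R G (fun t => b * t) t _ _ hG h.
  have hZ := @is_deriveZ _ _ _ _ (- (b ^+ 2)^-1) _ _ _ hc.
  apply: (is_derive_eq hZ).
  rewrite /shape /GRing.scale /=; field; rewrite gt_eqF //.
have cF : continuous F.
  by move=> t; apply/differentiable_continuous/derivable1_diffP; have [] := dF t.
have Foo : F t @[t --> +oo] --> (0 : R).
  apply/cvgrPdist_le => e e0; near=> t.
  have t0 : 0 < t by near: t; exact: nbhs_pinfty_gt.
  rewrite sub0r normrN normrM normrN (ger0_norm (profile_area_ge0 _ _)).
  rewrite ger0_norm ?invr_ge0 ?(ltW b2) // mulrC ler_pdivrMr //.
  apply: le_trans (profile_area_le d_gt0 (mulr_gt0 b_gt0 t0)) _.
  rewrite ler_pdivrMr ?mulr_gt0 //.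
  have eb : 0 < e * b ^+ 3 by rewrite mulr_gt0 // exprn_gt0.
  have : d.+1%:R / (e * b ^+ 3) <= t by near: t; apply: nbhs_pinfty_ge; exact: num_real.
  rewrite ler_pdivrMr // => h; apply: le_trans h _.
  by rewrite le_eqVlt; apply/orP; left; apply/eqP; ring.
rewrite integral_itv_obnd_cbnd; last first.
  apply/measurable_EFinP; apply: open_continuous_measurable_fun => //.
  by move=> t _; exact: continuous_shape.
rewrite (@ge0_continuous_FTC2y R shape F 0 0) //.
- rewrite /F mulr0 -EFinB sub0r mulNr opprK -(scale_sqr R d_gt0) -/b.
  by rewrite mulVf // gt_eqF.
- by move=> t _; exact: shape_ge0.
- exact/continuous_subspaceT/continuous_shape.
- exact: cvg_at_right_filter (cF 0).
- by move=> t _; rewrite derive1E; exact: (@derive_val _ _ _ _ _ _ _ (dF t)).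
Unshelve. all: by end_near. Qed.

Lemma scaling_function_sqrt : scaling_function sqrtn.
Proof.
split => [n n0|m n mn|].
- by rewrite sqrtr_gt0 ltr0n.
- by rewrite ltr_sqrt ?ltr_nat // ltr0n (leq_trans _ mn).
- apply/cvgryPge => A; near=> n.
  apply: le_trans (ler_norm A) _; rewrite -sqrtr_sqr ler_sqrt //.
  near: n; exact: nbhs_infty_ger.
Unshelve. all: by end_near. Qed.

Lemma scaled_diagram_sqrt lam t : (0 < sumn lam)%N ->
  scaled_diagram sqrtn lam t =
  (num_parts_ge lam (sqrtn (sumn lam) * t))%:R / sqrtn (sumn lam).
Proof.
move=> n0; rewrite /scaled_diagram mulrC; congr (_ * _).
have v0 : 0 < sqrtn (sumn lam) by rewrite sqrtr_gt0 ltr0n.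
apply: (mulIf (lt0r_neq0 v0)); rewrite mulVf ?gt_eqF // mulrAC -expr2 sqr_sqrtr //.
by rewrite divff // pnatr_eq0 -lt0n.
Qed.

Lemma limit_shape_shape : limit_shape sqrtn (partitions_diff d) shape.
Proof.
split; [exact: scaling_function_sqrt|exact: piecewise_continuous_shape
  |by move=> t _; exact: shape_ge0|exact: integral_shape|].
move=> ts eps tsP eps0.
pose D n (t : R) := deviates d_gt0 n t eps.
pose p n (t : R) : R := (count (D n t) (S n))%:R / (size (S n))%:R.
have p0 : \sum_(t <- ts) p n t @[n --> \oo] --> (0 : R).
  elim: ts tsP => [|t ts IH] tsP.
    by under eq_fun do rewrite big_nil; exact: cvg_cst.
  under eq_fun do rewrite big_cons.
  have h1 : p n t @[n --> \oo] --> (0 : R).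
    by apply: deviates_prob_cvg => //; have [|] := tsP t; rewrite ?mem_head.
  have h2 : \sum_(s <- ts) p n s @[n --> \oo] --> (0 : R).
    by apply: IH => s sts; apply: tsP; rewrite inE sts orbT.
  have h : p n t + \sum_(s <- ts) p n s @[n --> \oo] --> (0 + 0 : R) by exact: cvgD.
  by rewrite addr0 in h.
(* The lower bound is the union bound over the finitely many points. *)
apply: (@squeeze_cvgr _ _ _ _ (fun n => 1 - \sum_(t <- ts) p n t) (cst 1)).
- near=> n.
  have n0 : (0 < n)%N by near: n; exact: nbhs_infty_gt.
  rewrite uniform_prob_diff //.
  have S0 : 0 < (size (S n))%:R :> R by rewrite ltr0n size_sized_diff_parts_gt0.
  apply/andP; split; last first.
    by rewrite ler_pdivrMr // mul1r ler_nat count_size.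
  rewrite lerBlDr -(ler_pM2r S0) mul1r mulrDl divfK ?gt_eqF // mulr_suml.
  under [X in _ <= _ + X]eq_bigr do rewrite divfK ?gt_eqF //.
  rewrite -natr_sum -natrD ler_nat.
  apply: leq_trans (leq_add (leqnn _) (count_has_le _ _ _)).
  rewrite -(count_predC (fun lam => has ((D n)^~ lam) ts)) addnC leq_add2r.
  apply: sub_in_count => lam.
  rewrite mem_sized_diff_parts // => /andP[_ /eqP lamn] /= /hasPn H.
  apply/asboolP => t tts; rewrite scaled_diagram_sqrt lamn //.
  by have := H t tts; rewrite /D /deviates -ltNge.
- have h : 1 - \sum_(t <- ts) p n t @[n --> \oo] --> (1 - 0 : R).
    by apply: cvgB => //; exact: cvg_cst.
  by rewrite subr0 in h.
- exact: cvg_cst.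
Unshelve. all: by end_near. Qed.

(** Two events of probability above one half share a partition, whose diagram at [t] is within
    [e / 2] of both values. *)
Lemma limit_shape_unique Phi Psi :
  limit_shape sqrtn (partitions_diff d) Phi ->
  limit_shape sqrtn (partitions_diff d) Psi ->
  forall t, 0 < t -> {for t, continuous Phi} -> {for t, continuous Psi} ->
  Psi t = Phi t.
Proof.
move=> [_ _ _ _ HPhi] [_ _ _ _ HPsi] t t0 cPhi cPsi.
apply/eqP; rewrite -subr_eq0 -normr_le0; apply/ler_addgt0Pr => e e0; rewrite add0r.
have e2 : 0 < e / 2 by rewrite divr_gt0.
have P1 s : s \in [:: t] -> 0 < s /\ {for s, continuous Phi}.
  by rewrite inE => /eqP->.
have P2 s : s \in [:: t] -> 0 < s /\ {for s, continuous Psi}.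
  by rewrite inE => /eqP->.
have half : 1 / 2 < 1 :> R by lra.
have [n [h1 h2]] := filter_ex (filterI (cvgr_gt _ (HPhi _ _ P1 e2) _ half)
  (cvgr_gt _ (HPsi _ _ P2 e2) _ half)).
have S0 : 0 < (size (S n))%:R :> R by rewrite ltr0n size_sized_diff_parts_gt0.
rewrite !uniform_prob_diff // !ltr_pdivlMr // in h1 h2.
have : has (predI (fun lam => `[< forall s, s \in [:: t] ->
        `|scaled_diagram sqrtn lam s - Phi s| < e / 2 >])
      (fun lam => `[< forall s, s \in [:: t] ->
        `|scaled_diagram sqrtn lam s - Psi s| < e / 2 >])) (S n).
  rewrite has_count -(ltr_nat R).
  have := ltrD h1 h2; rewrite -natrD -count_predUI natrD => h.
  set U := count (predU _ _) _ in h.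
  have : U%:R <= (size (S n))%:R :> R by rewrite ler_nat count_size.
  lra.
move=> /hasP[lam _ /andP[/asboolP/(_ t (mem_head _ _)) A /asboolP/(_ t (mem_head _ _)) B]].
apply: le_trans (ler_distD (scaled_diagram sqrtn lam t) _ _) _.
by rewrite [ `|Psi t - _|]distrC; lra.
Unshelve. all: by end_near. Qed.

Lemma profile_eq t v : 0 < v ->
  g t = v <-> t = - d%:R * v - ln (1 - expR (- v)).
Proof.
move=> v0; split => [<-|tE]; first by rewrite profileK.
apply/esym/profile_unique.
have u1 : 0 < 1 - expR (- v) by rewrite subr_gt0 expR_lt1 oppr_lt0.
have -> : - t = d%:R * v + ln (1 - expR (- v)) by rewrite tE; ring.
rewrite expRD lnK ?posrE // -expRM_natl mulrAC -expRD mulrN subrr expR0.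
by ring.
Qed.

Lemma compositional_inverse_shape (w c gamma : R) :
  c / w = b -> c * gamma / w = g 0 ->
  compositional_inverse shape (fun x : R =>
    w / c *
    ln ((expR (c * gamma / w * d%:R) - expR (c * gamma / w * (d%:R - 1))) *
        (expR (- (c * d%:R / w * x)) / (1 - expR (- (c / w * x)))))).
Proof.
move=> cw cgw t x t0 x0.
have [_] := profileP d_gt0 (0 : R).
rewrite oppr0 expR0 mul1r => uE.
(* The saddle equation at 0, divided by [expR (- g 0) ^+ d], says that this prefactor is 1; the rest
   is [profileK] rescaled by [b]. *)
have -> : expR (c * gamma / w * d%:R) - expR (c * gamma / w * (d%:R - 1)) = 1.
  rewrite cgw mulrBr mulr1 expRD.
  have -> : expR (g 0 * d%:R) = (expR (- g 0) ^+ d)^-1.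
    by rewrite -expRM_natl -expRN mulrN opprK mulrC.
  rewrite -[X in X - _]mulr1 -mulrBr -[X in X - expR _]uE addrAC subrr add0r.
  by rewrite mulVf // gt_eqF // exprn_gt0 // expR_gt0.
have -> : w / c = b^-1 by rewrite -cw invf_div.
have -> : c * d%:R / w = d%:R * b by rewrite -cw; ring.
rewrite cw mul1r.
have bx : 0 < b * x by rewrite mulr_gt0.
have u1 : 0 < 1 - expR (- (b * x)) by rewrite subr_gt0 expR_lt1 oppr_lt0.
rewrite ln_div ?posrE ?expR_gt0 // expRK.
have -> : - (d%:R * b * x) = - d%:R * (b * x) by ring.
have bn : b != 0 by rewrite gt_eqF.
have H := profile_eq (b * t) bx; split => [xE|tE].
  have /H <- : g (b * t) = b * x by rewrite -xE /shape mulrCA divff // mulr1.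
  by rewrite mulKf.
have /H : b * t = - d%:R * (b * x) - ln (1 - expR (- (b * x))).
  by rewrite tE mulVKf.
by rewrite /shape => ->; rewrite mulrC mulKf.
Qed.

End LimitShape.

(** * Uniqueness of [c] and identification of the constants *)

(** With [u = c * gamma / w], the equation fixes the value of [Li2 (1 - expR (- u)) / u ^+ 2], which
    is strictly decreasing in [u]. *)
Lemma is_c_leq (R : realType) (gamma w c c' : R) : 0 < gamma / w ->
  is_c gamma w c -> is_c gamma w c' -> c' <= c.
Proof.
move=> k0 [c0 cE] [c'0 c'E]; rewrite leNgt; apply/negP => cc'.
pose x z := 1 - expR (- (z * (gamma / w))).
have x01 z : 0 < z -> 0 < x z < 1.
  by move=> z0; rewrite subr_gt0 expR_lt1 oppr_lt0 mulr_gt0 // ltrBlDr ltrDl expR_gt0.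
have lnx z : ln (1 - x z) = - (z * (gamma / w)) by rewrite subKr expRK.
have sq z : 0 < z -> z = Num.sqrt (Li2 (x z)) -> Li2 (x z) = z ^+ 2.
  move=> z0 zE; have /andP[h0 h1] := x01 z z0.
  rewrite {2}zE sqr_sqrtr //.
  by apply: le_trans (ltW h0) _; apply: Li2_ge; rewrite (ltW h0).
rewrite -mulrA -/(x c) in cE; rewrite -mulrA -/(x c') in c'E.
have /andP[xc0 _] := x01 c c0; have /andP[_ xc'1] := x01 c' c'0.
have xx : x c < x c' by rewrite ltrD2l ltrN2 ltr_expR ltrN2 ltr_pM2r.
have := Li2_ratio_lt xc0 xx xc'1.
rewrite (lnx c) (sq c' c'0 c'E) (sq c c0 cE) (lnx c') !sqrrN !exprMn => h.
lra.
Qed.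

Theorem theorem8p1 (R : realType) (d : nat) (hd : (1 <= d)%N) :
  exists y : R, unique (is_yd d) y /\
  let gamma := gamma_of d y in
  let w := w_of d gamma in
  exists c : R, unique (is_c gamma w) c /\
  exists Phi : R -> R,
    the_limit_shape (fun n : nat => Num.sqrt (n%:R : R))
      (partitions_diff d) Phi /\
    compositional_inverse Phi (fun x : R =>
      w / c *
      ln ((expR (c * gamma / w * d%:R) - expR (c * gamma / w * (d%:R - 1))) *
          (expR (- (c * d%:R / w * x)) / (1 - expR (- (c / w * x)))))).
Proof.
(* At energy 0 the saddle equation reads [u + u ^+ d = 1], which is the equation of [is_yd] for
   [y = 1 - u]. *)
pose g0 := profile hd (0 : R); pose y : R := 1 - expR (- g0).
have y01 : 0 < y < 1 by exact: onem_expR_profile.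
have [g00] := profileP hd (0 : R); rewrite oppr0 expR0 mul1r -/g0 => uE.
have lny : ln (1 - y) = - g0 by rewrite subKr expRK.
exists y; split.
  split; first by split => //; rewrite subKr /y -[X in X - _]uE; ring.
  move=> z [/andP[z0 z1] zE].
  have h : expR (- g0) = 1 - z.
    apply: (saddle_inj (d := d) ltr01); [exact: expR_gt0|lra|by rewrite mul1r|].
    by rewrite mul1r zE; ring.
  by rewrite /y h subKr.
(* From [b ^+ 2 = d / 2 * g0 ^+ 2 + c ^+ 2] come [gamma = g0 / b] and [w = c / b]; thus
   [c * gamma / w = g0], and the equation for [c] becomes its definition. *)
pose b := Num.sqrt (profile_area hd (0 : R)); pose c := Num.sqrt (Li2 y).
have b0 : 0 < b by exact: scale_gt0.
have L0 : 0 < Li2 y.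
  by case/andP: y01 => h0 h1; apply: (lt_le_trans h0); apply: Li2_ge; rewrite (ltW h0).
have c0 : 0 < c by rewrite sqrtr_gt0.
have cE : c ^+ 2 = Li2 y by rewrite sqr_sqrtr // ltW.
have gammaE : gamma_of d y = g0 / b.
  by rewrite /gamma_of lny opprK sqrrN addrC /b profile_areaE.
have wE : w_of d (g0 / b) = c / b.
  rewrite /w_of.
  have -> : 1 - d%:R / 2 * (g0 / b) ^+ 2 = (c / b) ^+ 2.
    have bE : b ^+ 2 = d%:R / 2 * g0 ^+ 2 + c ^+ 2.
      by rewrite scale_sqr cE profile_areaE.
    have bn : b ^+ 2 != 0 by rewrite gt_eqF // exprn_gt0.
    apply: (mulIf bn); rewrite mulrBl mul1r {1}bE.
    by field; rewrite gt_eqF.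
  by rewrite sqrtr_sqr ger0_norm // divr_ge0 // ltW.
move=> gamma w; rewrite /w /gamma gammaE wE.
have k0 : 0 < g0 / b / (c / b) by rewrite !divr_gt0.
have cg : c * (g0 / b) / (c / b) = g0 by field; rewrite !gt_eqF.
have cc : is_c (g0 / b) (c / b) c by split => //; rewrite cg.
exists c; split.
  split => // c' c'P; apply/eqP; rewrite eq_le.
  by rewrite (is_c_leq k0 cc c'P) (is_c_leq k0 c'P cc).
exists (shape hd); split.
  split; first exact: limit_shape_shape.
  by move=> Psi HPsi t t0 h1 h2; exact: limit_shape_unique (limit_shape_shape _ _) HPsi t t0 h1 h2.
apply: compositional_inverse_shape => //; rewrite -/b.
by field; rewrite !gt_eqF.
Qed.
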